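(* Let $U$ be a compact connected semisimple Lie group and let $\mathbb{F}_\Theta=\mathrm{Ad}(U)(iH)$ be a flag with dual flag $\mathbb{F}_{\Theta^*}=\mathrm{Ad}(U)(i\sigma(H))$. There exists a unique isotropic orbit of the diagonal action of $U$ on $\mathbb{F}_\Theta\times\mathbb{F}_{\Theta^*}$. Such orbit is Lagrangian and is given as the graph of $-\mathrm{id}:\mathrm{Ad}(U)(iH)\to\mathrm{Ad}(U)(i\sigma(H))$.
   Context: Let $\mathfrak{u}$ be the Lie algebra of $U$, $\langle\cdot,\cdot\rangle$ its Cartan--Killing form, $\mathfrak{t}=i\mathfrak{h}_{\mathbb{R}}$ the Lie algebra of a maximal torus; $H$ lies in the closure of the positive Weyl chamber of $\mathfrak{h}_{\mathbb{R}}$. The flags of the complex group with Lie algebra $\mathfrak{u}_{\mathbb{C}}$ are realized as adjoint orbits of $U$ in $\mathfrak{u}$, each with the Kirillov--Kostant--Souriau symplectic form $\omega_x([X,x],[Y,x])=\langle x,[X,Y]\rangle$; the product has the product symplectic form (sum of pullbacks from the factors). $\sigma=-w_0$ with $w_0$ the longest element of the Weyl group, so that $\mathrm{Ad}(U)(i\sigma(H))=\mathrm{Ad}(U)(-iH)$, and $\Theta^*=\sigma\Theta$. The diagonal action is $u\cdot(x,y)=(\mathrm{Ad}(u)x,\mathrm{Ad}(u)y)$. A submanifold is isotropic if the symplectic form restricts to zero on it, and Lagrangian if moreover it has half the dimension of the ambient manifold. *)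

(* Defs.v *)
From HB Require Import structures.
From mathcomp Require Import all_boot all_order all_algebra.
From mathcomp Require Import complex.
From mathcomp Require Import all_classical all_reals all_analysis.

Set Implicit Arguments.
Unset Strict Implicit.
Unset Printing Implicit Defensive.

Import Order.TTheory GRing.Theory Num.Theory.
Import numFieldNormedType.Exports.

Local Open Scope classical_set_scope.
Local Open Scope ring_scope.

Section Smooth.
Context {R : realType} {V W : normedModType R}.

Fixpoint iter_derive (vs : seq V) (f : V -> W) : V -> W :=
  if vs is v :: vs' then fun x => 'D_v (iter_derive vs' f) x else f.

(* [A] is meant to be open: every iterated directional derivative of [f] is
   differentiable, hence continuous, at every point of [A]. *)
Definition smooth_on (A : set V) (f : V -> W) : Prop :=
  forall vs x, A x -> differentiable (iter_derive vs f) x.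

(* Velocities at [x] of curves lying in [S]; when [S] is an embedded
   submanifold this is its usual tangent space at [x]. *)
Definition tangent_space (S : set V) (x : V) : set V :=
  [set v | exists g : R -> V,
    [/\ g 0 = x, forall t, S (g t) & is_derive (0 : R) (1 : R) g v]].

End Smooth.

Definition has_dim (R : realType) (V : vectType R) (A : set V) (d : nat) :=
  exists2 E : {vspace V}, (forall v, A v <-> v \in E) & \dim E = d.

(* [cmap] and [cinv] are total functions; only their values on [cdom] and on
   [cmap @` cdom] are meaningful. *)
Record chart (R : realType) (V : normedModType R) (M : topologicalType) :=
  Chart { cdom : set M ; cmap :> M -> V ; cinv : V -> M }.

Section Charts.
Context {R : realType}.

Definition is_chart (V : normedModType R) (M : topologicalType)
    (c : chart V M) : Prop :=
  [/\ open (cdom c), open (c @` cdom c),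
      forall x, cdom c x -> cinv c (c x) = x,
      forall x, cdom c x -> {for x, continuous c} &
      forall y, (c @` cdom c) y -> {for y, continuous (cinv c)}].

Definition prod_chart (V W : normedModType R) (M N : topologicalType)
    (c : chart V M) (d : chart W N) : chart (V * W)%type (M * N)%type :=
  Chart (cdom c `*` cdom d) (fun p => (c p.1, d p.2))
        (fun q => (cinv c q.1, cinv d q.2)).

Definition smooth_in_charts (V W : normedModType R) (M N : topologicalType)
    (c : chart V M) (d : chart W N) (f : M -> N) : Prop :=
  smooth_on (c @` (cdom c `&` f @^-1` cdom d)) (fun v => d (f (cinv c v))).

End Charts.

HB.mixin Record isLieGroup (R : realType) (n : nat) G
    of Group G & Topological G := {
  atlas : set (chart 'rV[R]_n G) ;
  atlas_chart : forall c, atlas c -> is_chart c ;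
  atlas_cover : forall x : G, exists2 c, atlas c & cdom c x ;
  atlas_smooth : forall c d, atlas c -> atlas d -> smooth_in_charts c d id ;
  lie_hausdorff : hausdorff_space G ;
  lie_second_countable : @second_countable G ;
  lie_mulg_continuous : continuous (fun p : G * G => (p.1 * p.2)%g) ;
  lie_mulg_smooth : forall c d e, atlas c -> atlas d -> atlas e ->
    smooth_in_charts (prod_chart c d) e (fun p : G * G => (p.1 * p.2)%g) ;
  lie_invg_continuous : continuous (fun x : G => x^-1%g) ;
  lie_invg_smooth : forall c d, atlas c -> atlas d ->
    smooth_in_charts c d (fun x : G => x^-1%g)
}.

#[short(type="lieGroupType")]
HB.structure Definition LieGroup (R : realType) (n : nat) :=
  { G of isLieGroup R n G & Group G & Topological G }.

(* The tangent space at the identity, identified with R^n by means of a chart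
   [c] of the atlas around the identity. *)
Section LieAlgebra.
Context {R : realType} {n : nat} {U : lieGroupType R n}.
Variable c : chart 'rV[R]_n U.

Local Notation u := 'rV[R]_n.

(* Differential at the identity of the conjugation by [g]. *)
Definition Ad (g : U) (X : u) : u :=
  'D_X (fun y => c (g * cinv c y * g^-1)%g) (c 1%g).

(* Differential at the identity of [g |-> Ad g Y], in the direction [X]. *)
Definition bracket (X Y : u) : u := 'D_X (fun y => Ad (cinv c y) Y) (c 1%g).

Definition killing (X Y : u) : R :=
  \tr (lin1_mx (bracket X) *m lin1_mx (bracket Y)).

Definition lie_ideal (I : {vspace u}) : Prop :=
  forall X Y, Y \in I -> bracket X Y \in I.

Definition derived (I : {vspace u}) : {vspace u} :=
  <<[seq bracket X Y | X <- vbasis I, Y <- vbasis I]>>%VS.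

Definition solvable_ideal (I : {vspace u}) : Prop :=
  lie_ideal I /\ exists k, iter k derived I = 0%VS.

Definition semisimple : Prop := forall I, solvable_ideal I -> I = 0%VS.

Definition adjoint_orbit (X : u) : set u := [set Ad g X | g in [set: U]].

Definition diag_orbit (p : u * u) : set (u * u) :=
  [set (Ad g p.1, Ad g p.2) | g in [set: U]].

(* Kirillov-Kostant-Souriau form at [x]: it is <x, [X, Y]> for any [X], [Y] such
   that v = [X, x] and w = [Y, x]. *)
Definition kks (x v w : u) : R :=
  killing x (bracket (xget 0 [set X | bracket X x = v])
                     (xget 0 [set Y | bracket Y x = w])).

Definition kks2 (p v w : u * u) : R := kks p.1 v.1 w.1 + kks p.2 v.2 w.2.

Definition isotropic (S : set (u * u)) : Prop :=
  forall p, S p -> forall v w,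
    tangent_space S p v -> tangent_space S p w -> kks2 p v w = 0.

Definition lagrangian (S M : set (u * u)) : Prop :=
  isotropic S /\ forall p, S p -> exists d,
    has_dim (tangent_space S p) d /\ has_dim (tangent_space M p) d.*2.

Local Notation uC := 'rV[R[i]]_n.

Definition toC (X : u) : uC := map_mx (fun a : R => a%:C%C) X.
Definition rePart (Z : uC) : u := map_mx (@complex.Re R) Z.
Definition imPart (Z : uC) : u := map_mx (@complex.Im R) Z.

Definition bracketC (Z W : uC) : uC :=
  toC (bracket (rePart Z) (rePart W) - bracket (imPart Z) (imPart W))
  + 'i%C *: toC (bracket (rePart Z) (imPart W) + bracket (imPart Z) (rePart W)).

Definition AdC (g : U) (Z : uC) : uC :=
  toC (Ad g (rePart Z)) + 'i%C *: toC (Ad g (imPart Z)).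

Definition killingC (Z W : uC) : R[i] :=
  \tr (lin1_mx (bracketC Z) *m lin1_mx (bracketC W)).

(* iH as an element of the real form u; only used for H in h_R = -i t. *)
Definition imul (H : uC) : u := rePart ('i%C *: H).

Definition torus (T : set U) : Prop :=
  [/\ T 1%g /\ (forall x y, T x -> T y -> T (x * y^-1)%g),
      compact T, connected T & forall x y, T x -> T y -> (x * y = y * x)%g].

Definition maximal_torus (T : set U) : Prop :=
  torus T /\ forall T', torus T' -> T `<=` T' -> T' = T.

Section Roots.
Variable T : set U.

Definition torus_algebra : set u :=
  tangent_space (c @` (T `&` cdom c)) (c 1%g).

Definition hR : set uC :=
  [set H | exists2 A, torus_algebra A & 'i%C *: H = toC A].

(* Roots take real values on h_R; a root is represented by its restriction to
   h_R, extended by 0 so that equality of functions is equality on h_R. *)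
Definition lie_root (a : uC -> R) : Prop :=
  [/\ forall H, ~ hR H -> a H = 0,
      exists2 H, hR H & a H != 0 &
      exists2 X : uC, X != 0 &
        forall H, hR H -> bracketC H X = (a H)%:C%C *: X].

Definition positive_system (P : set (uC -> R)) : Prop :=
  [/\ forall a, P a -> lie_root a,
      forall a, lie_root a -> P a \/ P (fun H => - a H),
      forall a, P a -> ~ P (fun H => - a H) &
      forall a b, P a -> P b -> lie_root (fun H => a H + b H) ->
        P (fun H => a H + b H)].

(* [s] is, on h_R, the Killing-orthogonal reflection in the hyperplane a = 0. *)
Definition reflection (a : uC -> R) (s : uC -> uC) : Prop :=
  exists2 Ha, hR Ha /\ (forall H, hR H -> killingC Ha H = (a H)%:C%C) &
    forall H, hR H -> s H = H - (2 * a H / a Ha)%:C%C *: Ha.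

(* The Weyl group N_U(T) / T, acting on h_R. *)
Definition weyl (w : uC -> uC) : Prop :=
  exists2 g : U, [set (g * x * g^-1)%g | x in T] = T &
    forall H, hR H -> w H = AdC g H.

Variable P : set (uC -> R).

Definition simple_root (a : uC -> R) : Prop :=
  P a /\ ~ exists b b', [/\ P b, P b' & a = fun H => b H + b' H].

Definition chamber : set uC :=
  [set H | hR H /\ forall a, simple_root a -> 0 < a H].

(* The closure is taken in t = i h_R, inside the real space u. *)
Definition closed_chamber : set uC :=
  [set H | hR H /\ closure (imul @` chamber) (imul H)].

Fixpoint simple_word (k : nat) (w : uC -> uC) : Prop :=
  if k is k'.+1 then
    exists a s w', [/\ simple_root a, reflection a s, simple_word k' w' &
      forall H, hR H -> w H = s (w' H)]
  else forall H, hR H -> w H = H.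

Definition weyl_length (w : uC -> uC) (k : nat) : Prop :=
  simple_word k w /\ forall l, simple_word l w -> (k <= l)%N.

Definition longest (w0 : uC -> uC) : Prop :=
  weyl w0 /\ exists2 k, weyl_length w0 k &
    forall w l, weyl w -> weyl_length w l -> (l <= k)%N.

End Roots.
End LieAlgebra.

(* Main.v *)
From HB Require Import structures.
Require Import Defs.
From mathcomp Require Import all_boot all_order all_algebra.
From mathcomp Require Import complex.
From mathcomp Require Import all_classical all_reals all_analysis.
From mathcomp Require Import separable ring lra.

Set Implicit Arguments.
Unset Strict Implicit.
Unset Printing Implicit Defensive.

Import Order.TTheory GRing.Theory Num.Theory.
Import numFieldNormedType.Exports.

Local Open Scope classical_set_scope.
Local Open Scope ring_scope.

(** The diagonal orbit of (x, y) is isotropic only if x + y = 0. Indeed the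
    product form takes on the vectors ([X, x], [X, y]) and ([Y, x], [Y, y]) the
    value <x, [X, Y]> + <y, [X, Y]> = <[x + y, X], Y>; since the Killing form is
    nondegenerate, its vanishing makes x + y central, hence zero
    ([isotropic_diag_orbit]). Conversely a tangent vector of the graph of -id is
    of the form (v, -v), and the forms of the two factors cancel on such vectors
    ([isotropic_antidiagonal]). The dual flag is the opposite of the flag,
    because w0 acts on the Cartan subalgebra as Ad g for some g in U
    ([imulN_AdC]); so the graph lies in the product and is the orbit of
    (iH, -iH).

    It remains to see that the graph has half the dimension of the product,
    which follows at once when the tangent space of an adjoint orbit at x is
    known to be the linear space [u, x]. The tangent space is a set of
    velocities of curves that are only differentiable at one point, and the
    point is to show that no other velocity occurs ([adjoint_orbit_tangent]).
    Along a curve in the orbit the operators ad are all similar to ad x, so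
    the minimal polynomial p of ad x annihilates them. Differentiating this
    relation kills, in the decomposition v = [x, W] + z with [x, z] = 0 of the
    velocity, the component z, because p is separable
    ([isospectral_derivative]).

    Separability of p, the decomposition of v and nondegeneracy of the Killing
    form all come from one fact: the operators ad X are skew-symmetric for an
    inner product ([ad_skew]). It is the derivative at the identity of the
    existence of an inner product invariant under the compact group Ad U
    ([compact_group_inner_product]). No invariant measure is used: the supremum
    over the group of the norm of the translates of a form is a strictly convex
    invariant function, whose minimum point is fixed by the group
    ([compact_group_fixed_point]).

    The Lie algebra itself is that of the chart c. That the bracket is bilinear
    and satisfies the Jacobi identity is obtained by differentiating
    Ad (g h) = Ad g Ad h; antisymmetry then follows from the injectivity of ad,
    whose kernel is an abelian ideal. *)

(** * Real matrices similar to skew-symmetric ones *)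

Section RealMatrices.
Variable R : rcfType.

Lemma mulmx_rV_inj m n (A B : 'M[R]_(m, n)) :
  (forall v : 'rV[R]_m, v *m A = v *m B) -> A = B.
Proof. by move=> AB; apply/row_matrixP => i; rewrite !rowE. Qed.

Lemma mulmx_trmx_entry n (u : 'rV[R]_n) :
  (u *m u^T) 0 0 = \sum_j u 0 j ^+ 2.
Proof. by rewrite mxE; apply: eq_bigr => j _; rewrite mxE expr2. Qed.

Lemma mxtrace_mulmx_trmx m n (A : 'M[R]_(m, n)) :
  \tr (A *m A^T) = \sum_i \sum_j A i j ^+ 2.
Proof.
apply: eq_bigr => i _; rewrite mxE; apply: eq_bigr => j _.
by rewrite mxE expr2.
Qed.

Lemma mxtrace_mulmx_trmx_eq0 m n (A : 'M[R]_(m, n)) :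
  \tr (A *m A^T) = 0 -> A = 0.
Proof.
rewrite mxtrace_mulmx_trmx => /eqP.
rewrite psumr_eq0 => [/allP A0|i _]; last first.
  by apply: sumr_ge0 => j _; apply: sqr_ge0.
apply/matrixP => i j; rewrite mxE; apply/eqP.
have /eqP/eqP := A0 i (mem_index_enum _).
rewrite psumr_eq0 => [/allP Ai0|k _]; last exact: sqr_ge0.
by have := Ai0 j (mem_index_enum _); rewrite sqrf_eq0.
Qed.

Lemma trmx_mulmx_eq0 m n (A : 'M[R]_(m, n)) : A^T *m A = 0 -> A = 0.
Proof.
move=> A0; apply: trmx_inj; rewrite trmx0; apply: mxtrace_mulmx_trmx_eq0.
by rewrite trmxK A0 mxtrace0.
Qed.

(** Gram-Schmidt, one row at a time: as long as fewer than n rows are chosen,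
    the conditions of orthogonality to them have a nonzero solution. *)
Lemma orthonormal_basis n (B : 'M[R]_n) :
  B^T = B -> (forall u : 'rV[R]_n, u != 0 -> 0 < (u *m B *m u^T) 0 0) ->
  exists e : 'M[R]_n, e *m B *m e^T = 1%:M.
Proof.
move=> Bsym Bpos.
have: forall k, (k <= n)%N -> exists e : 'M[R]_(k, n), e *m B *m e^T = 1%:M.
  elim=> [_|k IHk ltkn]; first by exists 0; rewrite [LHS]flatmx0 [RHS]flatmx0.
  have [e eB] := IHk (ltnW ltkn).
  have: kermx (B *m e^T) != 0 :> 'M[R]_n.
    rewrite -mxrank_eq0 mxrank_ker subn_eq0 -ltnNge.
    exact: leq_ltn_trans (rank_leq_col _) ltkn.
  rewrite -nz_row_eq0; set u := nz_row _ => u_neq0.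
  have uBe : u *m B *m e^T = 0.
    by rewrite -mulmxA; apply/sub_kermxP/nz_row_sub.
  have q_gt0 := Bpos _ u_neq0; set q := (_ 0 0) in q_gt0.
  pose v := (Num.sqrt q)^-1 *: u.
  have vBe : v *m B *m e^T = 0 by rewrite -!scalemxAl uBe scaler0.
  have eBv : e *m B *m v^T = 0.
    by apply: trmx_inj; rewrite !trmx_mul trmxK Bsym mulmxA vBe !trmx0.
  have vv : v *m B *m v^T = 1%:M.
    rewrite [LHS]mx11_scalar; congr _%:M.
    rewrite linearZ /= -!scalemxAl -scalemxAr scalerA mxE -/q.
    by rewrite -invfM -expr2 sqr_sqrtr ?ltW // mulVf ?gt_eqF.
  have : col_mx v e *m B *m (col_mx v e)^T = 1%:M.
    by rewrite mul_col_mx tr_col_mx mul_col_row eB vBe eBv vv -scalar_mx_block.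
  by exists (col_mx v e).
by move=> /(_ n (leqnn n)).
Qed.

(** For a normal A, the vectors killed by A^2 are already killed by A: with
    X = A^T A C one gets X^T X = 0, hence X = 0, hence (A C)^T (A C) = 0. This
    is the form in which semisimplicity of normal matrices is used below. *)
Lemma normal_sqr_mulmx_eq0 n p (A : 'M[R]_n) (C : 'M[R]_(n, p)) :
  A^T *m A = A *m A^T -> A *m (A *m C) = 0 -> A *m C = 0.
Proof.
move=> normA AAC; apply: trmx_mulmx_eq0; rewrite trmx_mul -mulmxA.
suff -> : A^T *m (A *m C) = 0 by rewrite mulmx0.
apply: trmx_mulmx_eq0; rewrite trmx_mul trmxK -mulmxA (mulmxA A) -normA.
by rewrite -(mulmxA A^T) AAC !mulmx0.
Qed.

Lemma horner_mxM n (A : 'M[R]_n.+1) (p q : {poly R}) :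
  horner_mx A (p * q) = horner_mx A p *m horner_mx A q.
Proof. exact: rmorphM. Qed.

Lemma horner_mx_trmx n (A : 'M[R]_n.+1) (p : {poly R}) :
  (horner_mx A p)^T = horner_mx A^T p.
Proof.
elim/poly_ind: p => [|p c IHp]; first by rewrite !rmorph0 trmx0.
rewrite !rmorphD !rmorphM /= !horner_mx_X !horner_mx_C linearD /= tr_scalar_mx.
congr (_ + _); rewrite -!mulmxE trmx_mul IHp.
by apply/esym; apply: comm_horner_mx; apply/comm_mx_refl.
Qed.


(** If p annihilates A and q is prime to p, then q(A) is invertible. *)
Lemma coprime_Bezout_horner n (A : 'M[R]_n.+1) (p q : {poly R}) :
  coprimep p q -> horner_mx A p = 0 -> exists r, horner_mx A (r * q) = 1%:M.
Proof.
move=> /Bezout_eq1_coprimepP[[a b] /= abE] pA0; exists b.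
have := congr1 (horner_mx A) abE; rewrite rmorphD rmorphM /= pA0 mulr0 add0r.
by rewrite rmorph1.
Qed.

(** The rows of e are an orthonormal basis for an inner product of which S is
    an infinitesimal isometry, so that e S e^-1 is skew-symmetric. *)
Section SkewSimilar.
Variables (n : nat) (S e : 'M[R]_n).
Hypotheses (e_unit : e \in unitmx)
  (S_skew : (e *m S *m invmx e)^T = - (e *m S *m invmx e)).
Let N := e *m S *m invmx e.

(** The trace of the square of a skew-symmetric N is - tr (N N^T). *)
Lemma skew_mxtrace_sqr_eq0 : \tr (S *m S) = 0 -> S = 0.
Proof.
move=> trS; suff N0 : N = 0.
  have : invmx e *m N *m e = 0 by rewrite N0 mulmx0 mul0mx.
  by rewrite /N !mulmxA mulVmx // mul1mx mulmxKV.
apply: mxtrace_mulmx_trmx_eq0; rewrite S_skew mulmxN linearN /=.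
rewrite (_ : N *m N = e *m (S *m S *m invmx e)).
  by rewrite mxtrace_mulC mulmxKV // trS oppr0.
by rewrite /N !mulmxA mulmxKV.
Qed.

(** S and its square have the same row space; this splits the space into the
    image and the kernel of S. *)
Lemma skew_sub_sqrmx : (S <= S *m S)%MS.
Proof.
rewrite submxE; apply/eqP; set C := cokermx _.
have SSC : S *m (S *m C) = 0 by rewrite mulmxA mulmx_coker.
have /normal_sqr_mulmx_eq0 : N^T *m N = N *m N^T.
  by rewrite S_skew mulNmx mulmxN.
move=> /(_ _ (e *m C)) NNC.
have NeC : N *m (e *m C) = 0.
  have NE D : N *m (e *m D) = e *m (S *m D).
    by rewrite /N -!mulmxA mulKmx.
  by apply: NNC; rewrite !NE SSC mulmx0.
have : invmx e *m (N *m (e *m C)) = 0 by rewrite NeC mulmx0.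
by rewrite /N !mulmxA mulVmx // mul1mx mulmxKV.
Qed.

End SkewSimilar.

(** If d^2 divided the minimal polynomial p = d^2 r, the matrix d(S), which is
    similar to a normal one, would satisfy d(S) d(S) r(S) = 0, hence
    d(S) r(S) = 0, so p would divide d r, which forces d to be constant. *)
Lemma skew_separable n (S e : 'M[R]_n.+1) :
  e \in unitmx -> (e *m S *m invmx e)^T = - (e *m S *m invmx e) ->
  separable_poly (mxminpoly S).
Proof.
move=> e_unit; set N := e *m S *m invmx e => S_skew.
have minN f : horner_mx N f = e *m horner_mx S f *m invmx e.
  exact: horner_mx_uconj.
have mp0 : mxminpoly S != 0 by rewrite monic_neq0 ?mxminpoly_monic.
apply/separable_polyP; split=> [u v uv_dv | u _ su].
  rewrite coprimep_def -dvdp1; set d := gcdp u v.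
  have /dvdpP[r pE] : d * d %| mxminpoly S.
    by apply: dvdp_trans uv_dv; rewrite dvdp_mul ?dvdp_gcdl ?dvdp_gcdr.
  have dr0 : horner_mx S (d * r) = 0.
    have normd : (horner_mx N d)^T *m horner_mx N d
               = horner_mx N d *m (horner_mx N d)^T.
      rewrite horner_mx_trmx S_skew.
      by apply: comm_horner_mx; apply: comm_mx_horner;
        rewrite /comm_mx mulNmx mulmxN.
    have : horner_mx N d *m (horner_mx N d *m horner_mx N r) = 0.
      rewrite -!horner_mxM minN (_ : d * (d * r) = mxminpoly S).
        by rewrite mx_root_minpoly mulmx0 mul0mx.
      by rewrite pE mulrA mulrC.
    move=> /(normal_sqr_mulmx_eq0 normd); rewrite -horner_mxM minN => edr0.
    have : invmx e *m (e *m horner_mx S (d * r) *m invmx e) *m e = 0.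
      by rewrite edr0 mulmx0 mul0mx.
    by rewrite !mulmxA mulVmx // mul1mx mulmxKV.
  have /dvdpP[k kE] := mxminpoly_min dr0.
  have dr_neq0 : d * r != 0.
    by apply: contraNneq mp0 => dr0'; rewrite pE mulrCA (mulrC r) dr0' mulr0.
  apply/dvdpP; exists k; apply: (mulIf dr_neq0).
  by rewrite mul1r [LHS]kE pE -!mulrA (mulrCA r) (mulrC r).
apply: contraTneq su => du0; case sE: (size u) => [|[|k]] //.
have := congr1 (fun q : {poly R} => q`_k) du0.
have -> : u^`()`_k = lead_coef u *+ k.+1 by rewrite coef_deriv lead_coefE sE.
move/eqP; rewrite coef0 mulrn_eq0 lead_coef_eq0 -size_poly_eq0 sE.
by [].
Qed.

End RealMatrices.

(** * Differential calculus with matrices *)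

Section Calculus.
Variable R : realType.

Lemma linear_sum_delta (m n : nat) (W : lmodType R) (f : 'M[R]_(m, n) -> W) :
  linear f -> forall A, f A = \sum_i \sum_j A i j *: f (delta_mx i j).
Proof.
move=> lf A; pose g : {linear _ -> _} :=
  HB.pack f (GRing.isLinear.Build _ _ _ _ f lf).
rewrite -[f A]/(g A) {1}[A]matrix_sum_delta linear_sum.
apply: eq_bigr => i _; rewrite linear_sum; apply: eq_bigr => j _.
by rewrite linearZ.
Qed.

Lemma mul_rV_lin1_linear m n (f : 'rV[R]_m -> 'rV[R]_n) :
  linear f -> forall u, u *m lin1_mx f = f u.
Proof.
move=> lf u; pose g : {linear _ -> _} :=
  HB.pack f (GRing.isLinear.Build _ _ _ _ f lf).
exact: (mul_rV_lin1 g).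
Qed.

Lemma differentiable_bigsum (V W : normedModType R) n (f : 'I_n -> V -> W) x :
  (forall i, differentiable (f i) x) ->
  differentiable (fun y => \sum_i f i y) x.
Proof.
move=> df; rewrite (_ : (fun _ => _) = \sum_i f i).
  exact: differentiable_sum.
by apply/funext => y; rewrite fct_sumE.
Qed.

Lemma is_derive_bigsum (V W : normedModType R) n (f : 'I_n -> V -> W) df x v :
  (forall i, is_derive x v (f i) (df i)) ->
  is_derive x v (fun y => \sum_i f i y) (\sum_i df i).
Proof.
move=> dff; rewrite (_ : (fun _ => _) = \sum_i f i); first exact: is_derive_sum.
by apply/funext => y; rewrite fct_sumE.
Qed.

Lemma linear_mx_differentiable (m n : nat) (W : normedModType R)
  (f : 'M[R]_(m, n) -> W) A : linear f -> differentiable f A.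
Proof.
move=> lf; rewrite (_ : f = fun B => \sum_i \sum_j B i j *: f (delta_mx i j)).
  apply: differentiable_bigsum => i; apply: differentiable_bigsum => j.
  exact/differentiableZl/differentiable_coord.
by apply/funext => B; exact: linear_sum_delta.
Qed.

Lemma differentiable_mx (V : normedModType R) m n (F : V -> 'M[R]_(m, n)) x :
  (forall i j, differentiable (fun y => F y i j) x) -> differentiable F x.
Proof.
move=> dF; rewrite (_ : F = fun y => \sum_i \sum_j F y i j *: delta_mx i j).
  apply: differentiable_bigsum => i; apply: differentiable_bigsum => j.
  exact/differentiableZl.
by apply/funext => y; exact: matrix_sum_delta.
Qed.

Lemma differentiable_entry (V : normedModType R) m n
    (F : V -> 'M[R]_(m, n)) x i j :
  differentiable F x -> differentiable (fun y => F y i j) x.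
Proof.
move=> dF.
apply: (@differentiable_comp _ _ _ _ F (fun A : 'M[R]_(m, n) => A i j)) => //.
exact: differentiable_coord.
Qed.

Lemma is_derive_mxP (V : normedModType R) m n (F : V -> 'M[R]_(m, n)) dF x v :
  is_derive x v F dF <->
  forall i j, is_derive x v (fun y => F y i j) (dF i j).
Proof.
split=> [[dFx <-] i j|dFx].
  apply: DeriveDef; first exact: (derivable_mxP F x v).1.
  by rewrite derive_mx // mxE.
have dF' : derivable F x v by apply/derivable_mxP => i j; have [] := dFx i j.
apply: DeriveDef => //; rewrite derive_mx //; apply/matrixP => i j; rewrite mxE.
by have [_] := dFx i j.
Qed.

Lemma is_derive_linear (V : normedModType R) m n p q
    (f : 'M[R]_(m, n) -> 'M[R]_(p, q)) (F : V -> 'M[R]_(m, n)) dF x v :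
  linear f -> is_derive x v F dF -> is_derive x v (fun y => f (F y)) (f dF).
Proof.
move=> lf dFx; apply/is_derive_mxP => k l.
have fE A : f A k l = \sum_i \sum_j (f (delta_mx i j) k l) *: (A i j).
  rewrite [in LHS](linear_sum_delta lf) summxE; apply: eq_bigr => i _.
  by rewrite summxE; apply: eq_bigr => j _; rewrite mxE mulrC.
rewrite (_ : (fun _ => _) =
    fun y => \sum_i \sum_j f (delta_mx i j) k l *: F y i j).
  rewrite fE; apply: is_derive_bigsum => i; apply: is_derive_bigsum => j.
  by apply: is_deriveZ; move/is_derive_mxP : dFx; exact.
by apply/funext => y; exact: fE.
Qed.

Lemma is_derive_bilinear (V : normedModType R) m n m' n' p q
    (b : 'M[R]_(m, n) -> 'M[R]_(m', n') -> 'M[R]_(p, q))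
    (F : V -> 'M[R]_(m, n)) (G : V -> 'M[R]_(m', n')) dF dG x v :
  (forall B, linear (b^~ B)) -> (forall A, linear (b A)) ->
  is_derive x v F dF -> is_derive x v G dG ->
  is_derive x v (fun y => b (F y) (G y)) (b dF (G x) + b (F x) dG).
Proof.
move=> bl br dFx dGx.
have bE A B : b A B = \sum_i \sum_j A i j *: b (delta_mx i j) B.
  exact: (linear_sum_delta (bl B)).
rewrite (_ : (fun _ => _) =
    fun y => \sum_i \sum_j F y i j *: b (delta_mx i j) (G y)); last first.
  by apply/funext => y; exact: bE.
rewrite !bE -big_split /=; apply: is_derive_bigsum => i.
rewrite -big_split /=; apply: is_derive_bigsum => j.
have /is_derive_mxP dbG := is_derive_linear (br (delta_mx i j)) dGx.
move/is_derive_mxP : dFx => dFx.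
apply/is_derive_mxP => k l.
have := is_deriveM (dFx i j) (dbG k l); set h := (X in is_derive _ _ X _) => dh.
rewrite (_ : (fun _ => _) = h).
  by apply: is_derive_eq dh _; rewrite !mxE addrC [_ *: dF i j]mulrC.
by apply/funext => y; rewrite !mxE.
Qed.

Lemma derive_comp (V W X : normedModType R) (f : V -> W) (g : W -> X) x v :
  differentiable f x -> differentiable g (f x) ->
  'D_v (fun y => g (f y)) x = 'D_('D_v f x) g (f x).
Proof.
move=> df dg; rewrite !deriveE //; last exact: (differentiable_comp df dg).
by rewrite (diff_comp df dg).
Qed.

Lemma derive_pair_l (V W X : normedModType R) (f : V -> W) (b : X) x v :
  differentiable f x -> 'D_v (fun y => (f y, b)) x = ('D_v f x, 0).
Proof.
move=> df; rewrite !deriveE //; last exact: differentiable_pair.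
by rewrite diff_pair // diff_cst.
Qed.

Lemma derive_pair_r (V W X : normedModType R) (f : V -> W) (b : X) x v :
  differentiable f x -> 'D_v (fun y => (b, f y)) x = (0, 'D_v f x).
Proof.
move=> df; rewrite !deriveE //; last exact: differentiable_pair.
by rewrite diff_pair // diff_cst.
Qed.

Lemma is_derive_unique (V W : normedModType R) (f : V -> W) x v a b :
  is_derive x v f a -> is_derive x v f b -> a = b.
Proof. by move=> [_ <-] [_ <-]. Qed.

Lemma differentiable_near (V W : normedModType R) (f g : V -> W) x :
  (\near x, f x = g x) -> differentiable f x -> differentiable g x.
Proof.
move=> fg /diff_locallyP[dfc dfE].
have gE : g \o shift x = cst (g x) + 'd f x +o_ 0 id.
  apply/eqaddoP => eps eps_gt0; move/eqaddoP : dfE => /(_ eps eps_gt0).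
  have fg0 : \forall h \near 0, f (h + x) = g (h + x).
    by have := fg; rewrite (near_shift 0) subr0.
  by apply: filterS2 fg0 => h /= fgh; rewrite !fctE /= fgh (nbhs_singleton fg).
by apply/diff_locallyP; rewrite (diff_unique dfc gE).
Qed.

Lemma derive_linear (V W : normedModType R) (f : V -> W) x :
  differentiable f x -> linear (fun v => 'D_v f x).
Proof. by move=> df a u v; rewrite !deriveE // linearP. Qed.

End Calculus.

(** * Compact linear groups preserve an inner product *)

Section CompactGroups.
Variable R : realType.

Definition sqnorm n (v : 'rV[R]_n) : R := \sum_j v 0 j ^+ 2.

Lemma sqnormE n (v : 'rV[R]_n) : sqnorm v = (v *m v^T) 0 0.
Proof. by rewrite mulmx_trmx_entry. Qed.

Lemma sqnorm_ge0 n (v : 'rV[R]_n) : 0 <= sqnorm v.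
Proof. by apply: sumr_ge0 => j _; exact: sqr_ge0. Qed.

Lemma sqnorm_gt0 n (v : 'rV[R]_n) : v != 0 -> 0 < sqnorm v.
Proof.
move=> v0; rewrite lt_neqAle sqnorm_ge0 andbT; apply: contraNneq v0 => v0.
apply/eqP/(@mxtrace_mulmx_trmx_eq0 R 1 n).
by rewrite trace_mx11 -sqnormE.
Qed.

(** The parallelogram identity, in the form that expresses strict convexity. *)
Lemma sqnorm_midpoint n (a b : 'rV[R]_n) :
  sqnorm (2^-1 *: (a + b)) = (sqnorm a + sqnorm b) / 2 - sqnorm (a - b) / 4.
Proof.
rewrite /sqnorm -big_split /= !mulr_suml -sumrB; apply: eq_bigr => j _.
by rewrite !mxE; field.
Qed.

Lemma sqnorm_mul_differentiable n (A : 'M[R]_n) v :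
  differentiable (fun u : 'rV[R]_n => sqnorm (u *m A)) v.
Proof.
apply: differentiable_bigsum => j.
apply: (@differentiable_comp _ _ _ _ (fun u : 'rV[R]_n => (u *m A) 0 j)
  (fun x : R => x ^+ 2)); last exact/derivable1_diffP/exprn_derivable.
apply: (@differentiable_entry _ _ _ _ (mulmx^~ A)).
by apply: linear_mx_differentiable => k u w; rewrite mulmxDl scalemxAl.
Qed.

Lemma norm_le_sqnorm n (v : 'rV[R]_n) : `|v| <= 1 + sqnorm v.
Proof.
rewrite [leLHS]/Num.Def.normr /= mx_normrE; apply: bigmax_le => [|[i j] _].
  by rewrite addr_ge0 // sqnorm_ge0.
rewrite ord1 /= (@le_trans _ _ (1 + v 0 j ^+ 2)) //.
  rewrite -real_normK ?num_real //; have := sqr_ge0 (2^-1 - `|v 0 j|).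
  have := normr_ge0 (v 0 j); nra.
rewrite lerD2l /sqnorm (bigD1 j) //= lerDl sumr_ge0 // => k _.
exact: sqr_ge0.
Qed.

(** The supremum of the squared norm over an orbit is a strictly convex
    invariant function on K. It attains its minimum, and the minimum point is
    unique, hence fixed. The set L r below is a sublevel of this function. *)
Lemma compact_group_fixed_point (T : topologicalType) n (rho : T -> 'M[R]_n)
    (K : set 'rV[R]_n) :
  compact [set: T] -> (forall v, continuous (fun t => sqnorm (v *m rho t))) ->
  (exists t, rho t = 1%:M) -> (forall t, rho t \in unitmx) ->
  (forall s t, exists r, rho r = rho s *m rho t) ->
  closed K -> K !=set0 -> (forall a b, K a -> K b -> K (2^-1 *: (a + b))) ->
  (forall a t, K a -> K (a *m rho t)) ->
  exists2 b, K b & forall t, b *m rho t = b.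
Proof.
move=> cT crho [t1 rho1] rho_unit rhoM clK [a0 Ka0] midK rhoK.
have T0 : [set: T] !=set0 by exists t1.
have crhoT v : {within [set: T], continuous (fun t => sqnorm (v *m rho t))}.
  by apply: continuous_subspaceT; exact: crho.
pose L r := [set b | K b] `&`
  \bigcap_(t in [set: T]) [set b | sqnorm (b *m rho t) <= r].
have clL r : closed (L r).
  apply: closedI => //; apply: closed_bigI => t _.
  apply: (closed_comp _ (@closed_le _ r)) => b _.
  exact/differentiable_continuous/sqnorm_mul_differentiable.
pose A := [set r | L r !=set0].
have A_lb : lbound A 0.
  by move=> r [b [_ /(_ t1 I) /=]]; apply: le_trans; exact: sqnorm_ge0.
have infA : has_inf A.
  split; last by exists 0.
  have [t _ tmax] := compact_EVT_max T0 cT (crhoT a0).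
  exists (sqnorm (a0 *m rho t)), a0; split => // s _.
  by apply: tmax; rewrite inE.
pose rs := inf A.
have Lne k : L (rs + k.+1%:R^-1) !=set0.
  have k_gt0 : 0 < k.+1%:R^-1 :> R by rewrite invr_gt0.
  have [r [b [Kb bb]] rlt] := inf_adherent k_gt0 infA.
  by exists b; split => // t _; apply: le_trans (bb t I) (ltW rlt).
have Lmono r s : r <= s -> L r `<=` L s.
  by move=> rs' b [Kb bb]; split => // t _; apply: le_trans (bb t I) rs'.
have [bs bsL] := choice Lne.
have Lc : compact (L (rs + 1)).
  apply: bounded_closed_compact => //.
  exists (1 + (rs + 1)); split; first exact: num_real.
  move=> M MM b [_ /(_ t1 I)] /=; rewrite rho1 mulmx1 => bb.
  apply: le_trans (norm_le_sqnorm b) _; apply/ltW; apply: le_lt_trans MM.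
  by rewrite lerD2l.
(* A cluster point of almost minimizing points lies in every sublevel set. *)
have [b [Lb clb]] : L (rs + 1) `&` cluster (bs @ \oo) !=set0.
  apply: Lc; exists 0%N => // k _ /=; apply: (Lmono _ _ _ _ (bsL k)).
  by rewrite lerD2l invf_le1 // ler1n.
have Lk k : L (rs + k.+1%:R^-1) b.
  rewrite [L _](closure_id _).1 //; move: clb; rewrite clusterE; apply.
  exists k => // m /= km; apply: (Lmono _ _ _ _ (bsL m)).
  by rewrite lerD2l lef_pV2 ?posrE // ler_nat ltnS.
have [Kb _] := Lb.
have bmin t : sqnorm (b *m rho t) <= rs.
  apply/ler_addgt0Pr => e e0; have [k ke] : exists k, k.+1%:R^-1 <= e.
    exists (Num.truncn e^-1); rewrite invf_ple ?posrE //.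
    exact/ltW/truncnS_gt.
  by apply: le_trans ((Lk k).2 t I) _; rewrite lerD2l.
exists b => // t; apply/eqP; rewrite eq_sym -subr_eq0; apply: contraT => d0.
set d := b - b *m rho t in d0.
(* d is moved to a nonzero vector by every element of the group, uniformly so
   by compactness: the midpoint of b and its translate beats the minimum by at
   least m / 4. *)
have [s _ smin] := compact_EVT_min T0 cT (crhoT d).
have ds_gt0 : 0 < sqnorm (d *m rho s).
  apply: sqnorm_gt0; apply: contraNneq d0 => d0.
  by rewrite -(mulmxK (rho_unit s) d) d0 mul0mx.
set m := sqnorm (d *m rho s) in ds_gt0.
have : rs <= rs - m / 4.
  apply: ge_inf; first by exists 0.
  exists (2^-1 *: (b + b *m rho t)); split; first exact: midK (rhoK _ _ _).
  move=> u _ /=; rewrite -scalemxAl mulmxDl sqnorm_midpoint -mulmxBl -/d.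
  have [r rE] := rhoM t u.
  have := bmin u; have := bmin r; rewrite rE mulmxA.
  have : m <= sqnorm (d *m rho u) by apply: smin; rewrite inE.
  lra.
by rewrite lerBrDr gerDl leNgt divr_gt0.
Qed.

End CompactGroups.

Section InnerProduct.
Variable R : realType.

Lemma continuous_bigsum (T : topologicalType) k (F : 'I_k -> T -> R) :
  (forall i, continuous (F i)) -> continuous (fun x => \sum_i F i x).
Proof. by move=> cF; apply: continuous_big => //; exact: add_continuous. Qed.

Lemma continuous_mulmx (T : topologicalType) m n p
    (A : T -> 'M[R]_(m, n)) (B : T -> 'M[R]_(n, p)) :
  (forall i j, continuous (fun t => A t i j)) ->
  (forall i j, continuous (fun t => B t i j)) ->
  forall i j, continuous (fun t => (A t *m B t) i j).
Proof.
move=> cA cB i j.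
rewrite (_ : (fun _ => _) = fun t => \sum_k A t i k * B t k j).
  apply: continuous_bigsum => k t; apply: cvgM; [exact: cA|exact: cB].
by apply/funext => t; rewrite mxE.
Qed.

(** The fixed point theorem is applied to the action B |-> A_t B A_t^T on all
    matrices. Bounding the forms from below on each orbit by the least squared
    norm m u > 0 found there gives a closed convex invariant set that contains
    the identity and consists of positive definite forms. The fixed form need
    not be symmetric; its symmetrization is as good. *)
Lemma compact_group_inner_product (T : topologicalType) n (A : T -> 'M[R]_n) :
  compact [set: T] -> (forall i j, continuous (fun t => A t i j)) ->
  (exists t, A t = 1%:M) -> (forall t, A t \in unitmx) ->
  (forall s t, exists r, A r = A s *m A t) ->
  exists B, [/\ B^T = B,
    (forall u : 'rV[R]_n, u != 0 -> 0 < (u *m B *m u^T) 0 0)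
    & forall t, A t *m B *m (A t)^T = B].
Proof.
move=> cT cA [t1 A1] A_unit AM.
pose conj t (b : 'rV[R]_(n * n)) := mxvec (A t *m vec_mx b *m (A t)^T).
have conj_lin t : linear (conj t).
  by move=> k a b; rewrite /conj !linearP /= mulmxDl -scalemxAl linearP.
pose rho t := lin1_mx (conj t).
have rhoE b t : b *m rho t = conj t b by exact: mul_rV_lin1_linear.
have cconst k l (M : 'M[R]_(k, l)) i j : continuous (fun _ : T => M i j).
  by apply: cst_continuous.
have cAT i j : continuous (fun t => (A t)^T i j).
  rewrite (_ : (fun _ => _) = fun t => A t j i) //.
  by apply/funext => t; rewrite mxE.
have cmul (u : 'rV[R]_n) : continuous (fun t => sqnorm (u *m A t)).
  apply: continuous_bigsum => j t; apply: cvgM; apply: continuous_mulmx => //.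
have T0 : [set: T] !=set0 by exists t1.
have mE (u : 'rV[R]_n) :
    exists m, (u != 0 -> 0 < m) /\ forall t, m <= sqnorm (u *m A t).
  have [s _ smin] := compact_EVT_min T0 cT (continuous_subspaceT (cmul u)).
  exists (sqnorm (u *m A s)); split=> [u0|t]; last by apply: smin; rewrite inE.
  apply: sqnorm_gt0; apply: contraNneq u0 => uA0.
  by rewrite -(mulmxK (A_unit s) u) uA0 mul0mx.
have {mE}[m mE] := choice mE.
pose K := [set b : 'rV[R]_(n * n) |
  forall u t, m u <= (u *m A t *m vec_mx b *m (u *m A t)^T) 0 0].
have [b bpos bfix] : exists2 b, K b & forall t, b *m rho t = b.
  apply: compact_group_fixed_point => //.
  - move=> v; rewrite (_ : (fun _ => _) = fun t => sqnorm (conj t v)).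
      apply: continuous_bigsum => k; case/mxvec_indexP: k => i j t.
      rewrite (_ : (fun _ => _) =
          fun t => (A t *m vec_mx v *m (A t)^T) i j ^+ 2).
        have cAvA : forall i j,
            continuous (fun t => (A t *m vec_mx v *m (A t)^T) i j).
          by apply: continuous_mulmx => // k l; apply: continuous_mulmx.
        by apply: cvgM; exact: cAvA.
      by apply/funext => s; rewrite mxvecE.
    by apply/funext => t; rewrite rhoE.
  - exists t1; apply/row_matrixP => i; rewrite !rowE rhoE mulmx1 /conj A1.
    by rewrite mul1mx trmx1 mulmx1 vec_mxK.
  - move=> t; rewrite -row_free_unit -kermx_eq0; apply/rowV0P => b /sub_kermxP.
    rewrite rhoE /conj => /(congr1 vec_mx); rewrite mxvecK linear0 => E.
    have : invmx (A t) *m (A t *m vec_mx b *m (A t)^T) *m invmx (A t)^T = 0.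
      by rewrite E mulmx0 mul0mx.
    rewrite mulmxA mulmxK ?unitmx_tr // mulmxA mulVmx // mul1mx => b0.
    by rewrite -(vec_mxK b) b0 linear0.
  - move=> s t; have [r rE] := AM t s; exists r.
    apply/row_matrixP => i; rewrite !rowE mulmxA !rhoE /conj mxvecK rE.
    by rewrite trmx_mul !mulmxA.
  - rewrite (_ : K = \bigcap_(ut in [set: 'rV[R]_n * T]) [set b |
        m ut.1 <= (ut.1 *m A ut.2 *m vec_mx b *m (ut.1 *m A ut.2)^T) 0 0]).
      apply: closed_bigI => -[u t] _ /=.
      apply: (closed_comp _ (@closed_ge _ (m u))) => b _.
      apply: differentiable_continuous; apply: differentiable_entry.
      apply: linear_mx_differentiable => k x y.
      by rewrite linearP /= mulmxDr mulmxDl -scalemxAr -scalemxAl.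
    apply/seteqP; split=> [b bK [u t] _|b bK u t]; first exact: bK.
    exact: (bK (u, t)).
  - exists (mxvec 1%:M) => u t; rewrite mxvecK.
    by rewrite mulmx1 -sqnormE; have [] := mE u.
  - move=> a b apos bpos u t.
    rewrite linearZ linearD /= -scalemxAr -scalemxAl mulmxDr mulmxDl.
    rewrite mxE [X in _ * X]mxE.
    by have := apos u t; have := bpos u t; lra.
  - move=> a t apos u s; rewrite rhoE /conj mxvecK.
    have [r rE] := AM s t; have := apos u r; rewrite rE.
    by rewrite !trmx_mul !mulmxA.
have bfix' t : A t *m vec_mx b *m (A t)^T = vec_mx b.
  by rewrite -[RHS](congr1 vec_mx (bfix t)) rhoE /conj mxvecK.
exists (vec_mx b + (vec_mx b)^T); split => [|u u0|t].
- by rewrite linearD /= trmxK addrC.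
- have upos : 0 < (u *m vec_mx b *m u^T) 0 0.
    have [mpos _] := mE u; apply: lt_le_trans (mpos u0) _.
    by have := bpos u t1; rewrite A1 mulmx1.
  rewrite mulmxDr mulmxDl mxE addr_gt0 //.
  suff -> : u *m (vec_mx b)^T *m u^T = (u *m vec_mx b *m u^T)^T by rewrite mxE.
  by rewrite !trmx_mul trmxK mulmxA.
- rewrite mulmxDr mulmxDl bfix'; congr (_ + _).
  by rewrite -{2}(bfix' t) !trmx_mul trmxK mulmxA.
Qed.

End InnerProduct.

(** * The adjoint representation and the bracket *)

Section LieGroups.
Variables (R : realType) (n : nat) (U : lieGroupType R n).
Local Notation u := 'rV[R]_n.

Lemma cinv_near (d : chart u U) a : atlas d -> cdom d a ->
  \forall y \near d a, cdom d (cinv d y) /\ d (cinv d y) = y.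
Proof.
move=> d_atlas da; have [_ od cK _ _] := atlas_chart _ d_atlas.
have : nbhs (d a) (d @` cdom d) by apply: open_nbhs_nbhs; split => //; exists a.
by apply: filterS => _ [b db <-]; rewrite cK.
Qed.

Lemma cinvK (d : chart u U) a : atlas d -> cdom d a -> cinv d (d a) = a.
Proof.
by move=> d_atlas da; have [_ _ cK _ _] := atlas_chart _ d_atlas; exact: cK.
Qed.

Lemma chart_continuous (d : chart u U) a : atlas d -> cdom d a ->
  {for a, continuous d}.
Proof.
by move=> d_atlas da; have [_ _ _ cd _] := atlas_chart _ d_atlas; exact: cd.
Qed.

Lemma cinv_continuous (d : chart u U) a : atlas d -> cdom d a ->
  {for d a, continuous (cinv d)}.
Proof.
move=> d_atlas da; have [_ _ _ _ cd] := atlas_chart _ d_atlas.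
by apply: cd; exists a.
Qed.

Lemma cdom_near (S : topologicalType) (f : S -> U) (d : chart u U) x :
  {for x, continuous f} -> atlas d -> cdom d (f x) ->
  \forall y \near x, cdom d (f y).
Proof.
move=> cf d_atlas dfx; have [od _ _ _ _] := atlas_chart _ d_atlas.
by apply: cf; apply: open_nbhs_nbhs.
Qed.

Lemma continuous_mulg (S : topologicalType) (f g : S -> U) x :
  {for x, continuous f} -> {for x, continuous g} ->
  {for x, continuous (fun y => (f y * g y)%g)}.
Proof.
move=> cf cg; rewrite /prop_for /continuous_at.
apply: (@cvg_comp _ _ _ (fun y => (f y, g y)) (fun p : U * U => (p.1 * p.2)%g)).
  exact: cvg_pair cf cg.
exact: (lie_mulg_continuous (f x, g x)).
Qed.

Lemma mulg_chart_smooth (d1 d2 d3 : chart u U) a b vs :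
  atlas d1 -> atlas d2 -> atlas d3 ->
  cdom d1 a -> cdom d2 b -> cdom d3 (a * b)%g ->
  differentiable
    (iter_derive vs (fun v : u * u => d3 (cinv d1 v.1 * cinv d2 v.2)%g))
    (d1 a, d2 b).
Proof.
move=> ad1 ad2 ad3 d1a d2b d3ab; apply: (lie_mulg_smooth _ _ _ ad1 ad2 ad3).
by exists (a, b).
Qed.

Lemma invg_chart_differentiable (d1 d2 : chart u U) a :
  atlas d1 -> atlas d2 -> cdom d1 a -> cdom d2 a^-1%g ->
  differentiable (fun v => d2 (cinv d1 v)^-1%g) (d1 a).
Proof.
move=> ad1 ad2 d1a d2a; apply: (lie_invg_smooth _ _ ad1 ad2 [::]).
by exists a.
Qed.

Variable c : chart u U.
Hypotheses (c_atlas : atlas c) (c_one : cdom c 1%g).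
Local Notation o := (c 1%g).

Definition conj_chart (g : U) (y : u) : u := c (g * cinv c y * g^-1)%g.

Lemma conj_chart1 g : conj_chart g o = o.
Proof. by rewrite /conj_chart cinvK // mulg1 mulgV. Qed.

Lemma conj_continuous g :
  {for o, continuous (fun y => g * cinv c y * g^-1)%g}.
Proof.
apply: continuous_mulg; last exact: cst_continuous.
by apply: continuous_mulg; [exact: cst_continuous|exact: cinv_continuous].
Qed.

Lemma conj_cdom_near g : \forall y \near o, cdom c (g * cinv c y * g^-1)%g.
Proof.
apply: cdom_near => //; first exact: conj_continuous.
by rewrite cinvK // mulg1 mulgV.
Qed.

(** The product g y need not lie in the domain of c, so conjugation is written
    as a left translation into a chart d around g followed by a right
    translation back to c. *)
Lemma conj_chart_differentiable g : differentiable (conj_chart g) o.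
Proof.
have [d ad dg] := atlas_cover g; have [d' ad' dg'] := atlas_cover g^-1%g.
have dl : differentiable (fun y => d (g * cinv c y)%g) o.
  apply: (@differentiable_near _ _ _ (fun y => d (cinv d (d g) * cinv c y)%g)).
    by near=> y; rewrite cinvK.
  apply: (@differentiable_comp _ _ _ _ (fun y => (d g, y))
    (fun v : u * u => d (cinv d v.1 * cinv c v.2)%g)).
    exact: differentiable_pair.
  by apply: (@mulg_chart_smooth d c d g 1%g [::]) => //; rewrite mulg1.
have dr : differentiable (fun w => c (cinv d w * g^-1)%g) (d g).
  apply: (@differentiable_near _ _ _
    (fun w => c (cinv d w * cinv d' (d' g^-1))%g)).
    by near=> y; rewrite cinvK.
  apply: (@differentiable_comp _ _ _ _ (fun w => (w, d' g^-1%g))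
    (fun v : u * u => c (cinv d v.1 * cinv d' v.2)%g)).
    exact: differentiable_pair.
  by apply: (@mulg_chart_smooth d d' c g g^-1%g [::]) => //; rewrite mulgV.
apply: (@differentiable_near _ _ _
  (fun y => c (cinv d (d (g * cinv c y)) * g^-1)%g)).
  near=> y; rewrite cinvK //; near: y.
    apply: (@cdom_near _ (fun y => (g * cinv c y)%g)) => //.
    by apply: continuous_mulg; [exact: cst_continuous|exact: cinv_continuous].
  by rewrite cinvK // mulg1.
apply: (@differentiable_comp _ _ _ _ (fun y => d (g * cinv c y)%g)
  (fun w => c (cinv d w * g^-1)%g)) => //.
by rewrite cinvK // mulg1.
Unshelve. all: by end_near. Qed.

Lemma Ad_linear g : linear (Ad c g).
Proof. exact: derive_linear (conj_chart_differentiable g). Qed.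

Lemma Ad_mul g h X : Ad c (g * h)%g X = Ad c g (Ad c h X).
Proof.
have E : \forall y \near o,
    conj_chart g (conj_chart h y) = conj_chart (g * h)%g y.
  have := conj_cdom_near h; apply: filterS => y hy.
  by rewrite /conj_chart cinvK // invgM !mulgA.
rewrite -[LHS](near_eq_derive _ E) derive_comp ?conj_chart1 //.
- exact: conj_chart_differentiable.
- exact: conj_chart_differentiable.
Qed.

Lemma Ad1 X : Ad c 1%g X = X.
Proof.
have E : \forall y \near o, y = conj_chart 1%g y.
  have := cinv_near c_atlas c_one; apply: filterS => y [_ cy].
  by rewrite /conj_chart mul1g invg1 mulg1.
by rewrite -[LHS](near_eq_derive _ E) derive_id.
Qed.

Definition mul_chart (p : u * u) : u := c (cinv c p.1 * cinv c p.2)%g.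
Definition inv_chart (y : u) : u := c (cinv c y)^-1%g.

Lemma mul_chart_smooth a b vs : cdom c a -> cdom c b -> cdom c (a * b)%g ->
  differentiable (iter_derive vs mul_chart) (c a, c b).
Proof. by move=> ca cb cab; exact: mulg_chart_smooth. Qed.

Lemma inv_chart_near : \forall y \near o, cdom c (cinv c y)^-1%g.
Proof.
apply: (@cdom_near _ (fun y => (cinv c y)^-1%g)) => //.
  apply: (@continuous_comp _ _ _ (cinv c) (fun x : U => x^-1%g)).
    exact: cinv_continuous.
  exact: lie_invg_continuous.
by rewrite cinvK // invg1.
Qed.

Lemma inv_chart1 : inv_chart o = o.
Proof. by rewrite /inv_chart cinvK // invg1. Qed.

(** Conjugation by y is z |-> m(m(y, z), y^-1), where m is the multiplication
    read in the chart. By the chain rule its differential is expressed with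
    first partial derivatives of m only, so that the dependence on y is as
    smooth as they are. *)
Lemma Ad_cinv_near Y : \forall y \near o, Ad c (cinv c y) Y =
  \sum_i ('D_(0, Y) mul_chart (y, o)) 0 i *:
     'D_(delta_mx 0 i, 0) mul_chart (y, inv_chart y).
Proof.
have := cinv_near c_atlas c_one.
apply: filterS2 inv_chart_near => y cVy [cy yE].
have dyo : differentiable mul_chart (y, o).
  have := @mul_chart_smooth (cinv c y) 1%g [::] cy c_one.
  by rewrite mulg1 yE; exact.
have dyV : differentiable mul_chart (y, inv_chart y).
  have := @mul_chart_smooth (cinv c y) (cinv c y)^-1%g [::] cy cVy.
  by rewrite mulgV yE; exact.
have dpair : differentiable (fun z : u => (y, z)) o.
  exact: differentiable_pair.
have dz : differentiable (fun z => mul_chart (y, z)) o.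
  exact: (@differentiable_comp _ _ _ _ (fun z : u => (y, z)) mul_chart).
have mulyo : mul_chart (y, o) = y by rewrite /mul_chart /= cinvK // mulg1.
have E : \forall z \near o,
    mul_chart (mul_chart (y, z), inv_chart y) = conj_chart (cinv c y) z.
  have : \forall z \near o, cdom c (cinv c y * cinv c z)%g.
    apply: (@cdom_near _ (fun z => (cinv c y * cinv c z)%g)) => //.
      by apply: continuous_mulg; [exact: cst_continuous|exact: cinv_continuous].
    by rewrite cinvK // mulg1.
  by apply: filterS => z cyz; rewrite /mul_chart /= !cinvK.
rewrite -[LHS](near_eq_derive _ E).
rewrite (@derive_comp _ _ _ _
  (fun z => (mul_chart (y, z), inv_chart y)) mul_chart) //.
- rewrite derive_pair_l // mulyo.
  rewrite (@derive_comp _ _ _ _ (fun z : u => (y, z)) mul_chart) //.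
  rewrite derive_pair_r // derive_id.
  set w := 'D_(0, Y) _ _.
  have /linear_sum_delta -> :
      linear (fun w : u => 'D_(w, 0) mul_chart (y, inv_chart y)).
    move=> k a b; rewrite (_ : (k *: a + b, 0) = k *: (a, 0) + (b, 0)).
      exact: derive_linear.
    by congr pair; rewrite /= scaler0 addr0.
  by rewrite big_ord1.
- exact: differentiable_pair.
- by rewrite mulyo.
Qed.

Lemma Ad_cinv_differentiable Y : differentiable (fun y => Ad c (cinv c y) Y) o.
Proof.
apply: (differentiable_near (x := o)
  (f := fun y => \sum_i ('D_(0, Y) mul_chart (y, o)) 0 i *:
     'D_(delta_mx 0 i, 0) mul_chart (y, inv_chart y))).
  by have := Ad_cinv_near Y; apply: filterS => y ->.
have dm vs : differentiable (iter_derive vs mul_chart) (o, o).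
  by apply: mul_chart_smooth => //; rewrite mulg1.
have dinv : differentiable inv_chart o.
  by apply: invg_chart_differentiable => //; rewrite invg1.
apply: differentiable_bigsum => i.
have d1 : differentiable (fun y => 'D_(0, Y) mul_chart (y, o)) o.
  apply: (@differentiable_comp _ _ _ _ (fun y => (y, o))
    (iter_derive [:: (0, Y)] mul_chart)).
    exact: differentiable_pair.
  exact: dm.
have d2 :
    differentiable (fun y => 'D_(delta_mx 0 i, 0) mul_chart (y, inv_chart y)) o.
  apply: (@differentiable_comp _ _ _ _ (fun y => (y, inv_chart y))
     (iter_derive [:: (delta_mx 0 i, 0)] mul_chart)).
    exact: differentiable_pair.
  by rewrite inv_chart1; exact: dm.
apply: differentiable_mx => k l.
rewrite (_ : (fun _ => _) = (fun y => ('D_(0, Y) mul_chart (y, o)) 0 i) *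
   (fun y => ('D_(delta_mx 0 i, 0) mul_chart (y, inv_chart y)) k l)).
  by apply: differentiableM; exact: differentiable_entry.
by apply/funext => y; rewrite !mxE.
Qed.

Lemma bracket_is_derive X Y :
  is_derive o X (fun y => Ad c (cinv c y) Y) (bracket c X Y).
Proof.
by apply: DeriveDef => //; apply: diff_derivable; exact: Ad_cinv_differentiable.
Qed.

Lemma bracket_linear_l Y : linear (bracket c ^~ Y).
Proof. exact: derive_linear (Ad_cinv_differentiable Y). Qed.

Lemma bracket_linear_r X : linear (bracket c X).
Proof.
move=> k Y Z; apply: is_derive_unique (bracket_is_derive X _) _.
rewrite (_ : (fun _ => _) =
  k *: (fun y => Ad c (cinv c y) Y) + (fun y => Ad c (cinv c y) Z)).
  apply: is_deriveD; last exact: bracket_is_derive.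
  by apply: is_deriveZ; exact: bracket_is_derive.
by apply/funext => y; rewrite Ad_linear.
Qed.

(** Both sides are derivatives at the identity, in the direction X, of
    Ad (g y g^-1) (Ad g Y) = Ad g (Ad y Y). *)
Lemma Ad_bracket g X Y :
  Ad c g (bracket c X Y) = bracket c (Ad c g X) (Ad c g Y).
Proof.
apply: is_derive_unique
  (is_derive_linear (Ad_linear g) (bracket_is_derive X Y)) _.
apply: (@near_eq_is_derive _ _ _
  (fun y => Ad c (cinv c (conj_chart g y)) (Ad c g Y))).
  have := conj_cdom_near g; apply: filterS => y hy.
  rewrite (cinvK c_atlas hy) -(Ad_mul _ g Y) -(Ad_mul g _ Y) mulgVK.
  by [].
have dg := conj_chart_differentiable g.
have dA : differentiable (fun y => Ad c (cinv c y) (Ad c g Y)) (conj_chart g o).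
  by rewrite conj_chart1; exact: Ad_cinv_differentiable.
apply: DeriveDef.
  by apply: diff_derivable; apply: (differentiable_comp dg dA).
by rewrite (derive_comp _ dg dA) conj_chart1.
Qed.

(** The Jacobi identity, obtained by differentiating the invariance
    Ad y [Y, Z] = [Ad y Y, Ad y Z] in the direction X. *)
Lemma bracket_derivation X Y Z : bracket c X (bracket c Y Z) =
  bracket c (bracket c X Y) Z + bracket c Y (bracket c X Z).
Proof.
apply: is_derive_unique (bracket_is_derive X _) _.
have Ao V : Ad c (cinv c o) V = V by rewrite (cinvK c_atlas c_one) Ad1.
have := is_derive_bilinear bracket_linear_l bracket_linear_r
  (bracket_is_derive X Y) (bracket_is_derive X Z).
rewrite (Ao Y) (Ao Z); apply: near_eq_is_derive; near=> y.
by rewrite Ad_bracket.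
Unshelve. all: by end_near. Qed.

End LieGroups.

(** * Derivatives of isospectral curves *)

Section Isospectral.
Variable R : realType.

(** The differential of S |-> q(S) takes a commutator [W, S] to [W, q(S)], and a
    matrix Z that commutes with S to q'(S) Z. *)
Lemma horner_mx_is_derive n (S W Z : 'M[R]_n.+1) (M : R -> 'M[R]_n.+1)
    (q : {poly R}) :
  M 0 = S -> is_derive (0 : R) (1 : R) M (W *m S - S *m W + Z) ->
  Z *m S = S *m Z ->
  is_derive (0 : R) (1 : R) (fun t => horner_mx (M t) q)
    (W *m horner_mx S q - horner_mx S q *m W + horner_mx S q^`() *m Z).
Proof.
move=> M0 dM ZS; elim/poly_ind: q => [|q k IHq].
  rewrite deriv0 !rmorph0 mulmx0 !mul0mx subr0 addr0.
  rewrite (_ : (fun _ => _) = cst 0); first exact: is_derive_cst.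
  by apply/funext => t; rewrite rmorph0.
have mull (B : 'M[R]_n.+1) : linear (fun A : 'M[R]_n.+1 => A *m B).
  by move=> a X Y; rewrite mulmxDl scalemxAl.
have mulr (A : 'M[R]_n.+1) : linear (fun B : 'M[R]_n.+1 => A *m B).
  by move=> a X Y; rewrite mulmxDr scalemxAr.
have D := is_deriveD (is_derive_cst (k%:M : 'M[R]_n.+1) (0 : R) (1 : R))
  (is_derive_bilinear mull mulr IHq dM).
have fE : cst k%:M + (fun t => horner_mx (M t) q *m M t) =
    (fun t => horner_mx (M t) (q * 'X + k%:P)).
  apply/funext => t; rewrite rmorphD /= horner_mxM horner_mx_X horner_mx_C.
  by rewrite addrC.
rewrite fE M0 in D; apply: is_derive_eq D _.
have -> : horner_mx S (q * 'X + k%:P) = horner_mx S q *m S + k%:M.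
  by rewrite rmorphD /= horner_mxM horner_mx_X horner_mx_C.
have -> : horner_mx S (q * 'X + k%:P)^`() =
    horner_mx S q^`() *m S + horner_mx S q.
  rewrite derivD derivM derivX derivC addr0 mulr1.
  by rewrite rmorphD /= horner_mxM horner_mx_X.
move: (horner_mx S q) (horner_mx S q^`()) => Q Q'.
rewrite add0r !mulmxDr !mulmxDl !mulNmx !mulmxN !mulmxA.
rewrite -(mulmxA Q' Z) ZS mulmxA scalar_mxC.
move: (W *m Q *m S) (Q *m W *m S) (Q' *m S *m Z) => a b x.
move: (Q *m S *m W) (Q *m Z) (k%:M *m W) => d f g.
rewrite addrACA subrKA; congr (_ + _).
by rewrite [d + g]addrC opprD addrA addrK.
Qed.

(** A curve of matrices similar to S is annihilated by the minimal polynomial p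
    of S. Differentiating p (M t) = 0 gives p'(S) Z = 0, and p'(S) is invertible
    because p is separable. Thus the velocity of an isospectral curve has no
    component that commutes with S, without any recourse to exponentials or to
    the manifold structure of conjugacy classes. *)
Lemma isospectral_derivative n (S e W Z : 'M[R]_n) (M : R -> 'M[R]_n) :
  e \in unitmx -> (e *m S *m invmx e)^T = - (e *m S *m invmx e) ->
  M 0 = S -> (forall t, exists2 g, g \in unitmx & M t = invmx g *m S *m g) ->
  is_derive (0 : R) (1 : R) M (W *m S - S *m W + Z) -> Z *m S = S *m Z -> Z = 0.
Proof.
case: n S e W Z M => [|n] S e W Z M; first by move=> *; apply: flatmx0.
move=> e_unit S_skew M0 Mconj dM ZS.
have cop : coprimep (mxminpoly S) (mxminpoly S)^`().
  by have := skew_separable e_unit S_skew; rewrite separable_poly.unlock.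
have [r rE] := coprime_Bezout_horner cop (mx_root_minpoly S).
have p0 t : horner_mx (M t) (mxminpoly S) = 0.
  have [g g_unit ->] := Mconj t.
  by rewrite horner_mx_uconjC // mx_root_minpoly mulmx0 mul0mx.
have d0 : is_derive (0 : R) (1 : R) (fun t => horner_mx (M t) (mxminpoly S)) 0.
  rewrite (_ : (fun _ => _) = cst 0); first exact: is_derive_cst.
  by apply/funext => t; rewrite p0.
have := is_derive_unique d0 (horner_mx_is_derive (mxminpoly S) M0 dM ZS).
rewrite mx_root_minpoly mulmx0 mul0mx subr0 add0r => pZ.
by rewrite -[Z]mul1mx -rE horner_mxM -mulmxA -pZ mulmx0.
Qed.

End Isospectral.

(** * Compact semisimple Lie algebras *)

(** The bracket and the matrices of ad and Ad are locked: their bodies are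
    limits of difference quotients, which the comparison of two brackets would
    unfold. *)
HB.lock Definition lie (R : realType) (n : nat) (U : lieGroupType R n)
  (c : chart 'rV[R]_n U) X Y := bracket c X Y.

HB.lock Definition ad_mx (R : realType) (n : nat) (U : lieGroupType R n)
  (c : chart 'rV[R]_n U) X : 'M[R]_n := lin1_mx (bracket c X).

HB.lock Definition Ad_mx (R : realType) (n : nat) (U : lieGroupType R n)
  (c : chart 'rV[R]_n U) g : 'M[R]_n := lin1_mx (Ad c g).

Section CompactSemisimple.
Variables (R : realType) (n : nat) (U : lieGroupType R n).
Variable c : chart 'rV[R]_n U.
Hypotheses (c_atlas : atlas c) (c_one : cdom c 1%g).
Local Notation u := 'rV[R]_n.
Local Notation o := (c 1%g).
Local Notation ad := (ad_mx c).
Local Notation Adm := (Ad_mx c).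
Local Notation br := (lie c).

Lemma lieE : br = bracket c.
Proof. by apply/funext => X; apply/funext => Y; rewrite lie.unlock. Qed.

Lemma mulmx_ad Y X : Y *m ad X = br X Y.
Proof.
rewrite ad_mx.unlock lieE.
exact: mul_rV_lin1_linear (bracket_linear_r c_atlas c_one X) Y.
Qed.

Lemma mulmx_Ad X g : X *m Adm g = Ad c g X.
Proof.
rewrite Ad_mx.unlock.
exact: mul_rV_lin1_linear (Ad_linear c_atlas c_one g) X.
Qed.

Lemma AdE g i j : Adm g i j = Ad c g (delta_mx 0 i) 0 j.
Proof. by rewrite Ad_mx.unlock mxE. Qed.

Lemma adE X i j : ad X i j = br X (delta_mx 0 i) 0 j.
Proof. by rewrite ad_mx.unlock lieE mxE. Qed.

Lemma killingE X Y : killing c X Y = \tr (ad X *m ad Y).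
Proof. by rewrite /killing ad_mx.unlock. Qed.

Lemma ad_linear : linear (fun X => ad X).
Proof.
move=> k X Y; apply: mulmx_rV_inj => v.
rewrite mulmxDr -scalemxAr !mulmx_ad.
by rewrite lieE; exact: (bracket_linear_l c_atlas c_one).
Qed.

Lemma adD X Y : ad (X + Y) = ad X + ad Y.
Proof. by have := ad_linear 1 X Y; rewrite !scale1r. Qed.

Lemma ad0 : ad 0 = 0.
Proof. by apply: (addrI (ad 0)); rewrite -adD !addr0. Qed.

Lemma adN X : ad (- X) = - ad X.
Proof.
by apply/eqP; rewrite -addr_eq0 -adD addNr ad0.
Qed.

Lemma lieNl X Y : br (- X) Y = - br X Y.
Proof. by rewrite -!mulmx_ad adN mulmxN. Qed.

Lemma lieNr X Y : br X (- Y) = - br X Y.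
Proof. by rewrite -!mulmx_ad mulNmx. Qed.

Lemma ad_lie X Y : ad (br X Y) = ad Y *m ad X - ad X *m ad Y.
Proof.
apply: mulmx_rV_inj => v; rewrite mulmxBr !mulmxA !mulmx_ad.
by rewrite lieE (bracket_derivation c_atlas c_one X Y v) addrK.
Qed.

Lemma Adm_mul g h : Adm (g * h)%g = Adm h *m Adm g.
Proof.
by apply: mulmx_rV_inj => v; rewrite mulmxA !mulmx_Ad (Ad_mul c_atlas c_one).
Qed.

Lemma Adm_1 : Adm 1%g = 1%:M.
Proof.
by apply: mulmx_rV_inj => v; rewrite mulmx_Ad mulmx1 (Ad1 c_atlas c_one).
Qed.

Lemma Adm_mulV g : Adm g *m Adm g^-1%g = 1%:M.
Proof. by rewrite -Adm_mul mulVg Adm_1. Qed.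

Lemma Adm_unit g : Adm g \in unitmx.
Proof. by have [] := mulmx1_unit (Adm_mulV g). Qed.

Lemma ad_Ad g X : ad (Ad c g X) = invmx (Adm g) *m ad X *m Adm g.
Proof.
apply: (can_inj (mulKmx (Adm_unit g))).
rewrite !mulmxA mulmxV ?Adm_unit // mul1mx.
apply: mulmx_rV_inj => v; rewrite !mulmxA !mulmx_ad !mulmx_Ad.
by rewrite lieE (Ad_bracket c_atlas c_one).
Qed.

(** Continuity at the identity spreads to every g, since
    Ad k = Ad g (Ad (g^-1 k)). *)
Lemma Ad_continuous X : continuous (fun g => Ad c g X).
Proof.
have c1 Y : {for 1%g, continuous (fun g => Ad c g Y)}.
  have cA : {for 1%g, continuous ((fun y => Ad c (cinv c y) Y) \o c)}.
    apply: (@continuous_comp _ _ _ c (fun y => Ad c (cinv c y) Y)).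
      exact: chart_continuous.
    exact/differentiable_continuous/Ad_cinv_differentiable.
  move: cA; rewrite /prop_for /continuous_at /= (cinvK c_atlas c_one).
  apply: cvg_trans; apply: near_eq_cvg.
  have [oc _ _ _ _] := atlas_chart _ c_atlas.
  have : nbhs 1%g (cdom c) by apply: open_nbhs_nbhs.
  by apply: filterS => g cg /=; rewrite cinvK.
move=> g; rewrite (_ : (fun _ => _) = fun k => Ad c g (Ad c (g^-1 * k)%g X)).
  apply: (@continuous_comp _ _ _ (fun k => Ad c (g^-1 * k)%g X) (Ad c g)).
    apply: (@continuous_comp _ _ _ (fun k => (g^-1 * k)%g) (fun k => Ad c k X)).
      by apply: continuous_mulg; [exact: cst_continuous|exact: cvg_id].
    by rewrite mulVg; exact: c1.
  exact/differentiable_continuous/linear_mx_differentiable/Ad_linear.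
by apply/funext => k; rewrite -(Ad_mul c_atlas c_one) mulVKg.
Qed.

Lemma Adm_continuous i j : continuous (fun g => Adm g i j).
Proof.
rewrite (_ : (fun _ => _) =
    (fun v : u => v 0 j) \o (fun g => Ad c g (delta_mx 0 i))).
  move=> g; apply: continuous_comp; first exact: Ad_continuous.
  exact: coord_continuous.
by apply/funext => g; rewrite AdE.
Qed.

Lemma ad_is_derive X : is_derive o X (fun y => Adm (cinv c y)) (ad X).
Proof.
apply/is_derive_mxP => i j; rewrite adE.
have := bracket_is_derive c_atlas c_one X (delta_mx 0 i).
rewrite lieE => /is_derive_mxP/(_ 0 j).
by congr is_derive; apply/funext => y; rewrite AdE.
Qed.

Hypothesis U_compact : compact [set: U].

(** Differentiating the invariance Ad y B Ad y^T = B of an inner product B gives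
    ad X B + B ad X^T = 0, which is skew-symmetry in an orthonormal basis. *)
Lemma ad_skew : exists2 e, e \in unitmx &
  forall X, (e *m ad X *m invmx e)^T = - (e *m ad X *m invmx e).
Proof.
have [B [Bsym Bpos Binv]] : exists B, [/\ B^T = B,
    (forall v : u, v != 0 -> 0 < (v *m B *m v^T) 0 0)
    & forall g : U, Adm g *m B *m (Adm g)^T = B].
  apply: compact_group_inner_product => //.
  - exact: Adm_continuous.
  - by exists 1%g; exact: Adm_1.
  - exact: Adm_unit.
  - by move=> g h; exists (h * g)%g; rewrite Adm_mul.
have [e eBe] := orthonormal_basis Bsym Bpos.
have [e_unit _] := mulmx1_unit (etrans (mulmxA _ _ _) eBe).
exists e => // X.
have eV : invmx e = B *m e^T.
  by rewrite -[LHS]mulmx1 -eBe !mulmxA mulVmx // mul1mx.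
have adB : ad X *m B + B *m (ad X)^T = 0.
  have bl (Q : 'M[R]_n) : linear (fun P : 'M[R]_n => P *m B *m Q^T).
    by move=> k a b; rewrite !mulmxDl !scalemxAl.
  have br (P : 'M[R]_n) : linear (fun Q : 'M[R]_n => P *m B *m Q^T).
    by move=> k a b; rewrite linearP /= mulmxDr scalemxAr.
  have := is_derive_bilinear bl br (ad_is_derive X) (ad_is_derive X).
  rewrite (cinvK c_atlas c_one) Adm_1 trmx1 mulmx1 mul1mx => D.
  apply: is_derive_unique D _; rewrite (_ : (fun _ => _) = cst B).
    exact: is_derive_cst.
  by apply/funext => y; rewrite Binv.
rewrite eV !trmx_mul !trmxK Bsym !mulmxA.
apply/eqP; rewrite -addr_eq0; apply/eqP.
rewrite -(mulmxA e B) -(mulmxA e (ad X)) -mulmxDl -mulmxDr addrC adB.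
by rewrite mulmx0 mul0mx.
Qed.

Hypothesis U_semisimple : semisimple c.

(** The kernel of ad is an abelian ideal. *)
Lemma ad_inj Z : ad Z = 0 -> Z = 0.
Proof.
pose f Y : 'rV[R]_(n * n) := mxvec (ad Y).
have f_lin : linear f by move=> k a b; rewrite /f ad_linear linearP.
pose I := lker (linfun (mulmxr (lin1_mx f)) : 'Hom(u, 'rV[R]_(n * n))).
have memI Y : (Y \in I) = (ad Y == 0).
  by rewrite memv_ker lfunE /= mul_rV_lin1_linear // mxvec_eq0.
have I0 : I = 0%VS.
  apply: U_semisimple; split.
    move=> X Y; rewrite -lieE !memI ad_lie => /eqP ->.
    by rewrite mulmx0 mul0mx subrr.
  exists 1%N; apply/eqP; rewrite -subv0.
  apply/span_subvP => _ /allpairsP[[X Y] /= [XI YI ->]].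
  have := vbasis_mem XI; rewrite memI => /eqP adX.
  by rewrite memv0 -lieE -mulmx_ad adX mulmx0.
by move=> Z0; apply/eqP; rewrite -memv0 -I0 memI Z0.
Qed.

(** By the Jacobi identity ad [X, Y] = - ad [Y, X], and ad is injective. This
    replaces the symmetry of second derivatives. *)
Lemma lie_anticomm X Y : br X Y = - br Y X.
Proof.
apply/eqP; rewrite -addr_eq0; apply/eqP/ad_inj.
by rewrite adD !ad_lie subrKA subrr.
Qed.

Lemma killing_invariant X Y Z :
  killing c X (br Y Z) = killing c (br X Y) Z.
Proof.
rewrite !killingE !ad_lie mulmxBr mulmxBl !linearB /= !mulmxA; congr (_ - _).
by rewrite [RHS]mxtrace_mulC mulmxA [RHS]mxtrace_mulC mulmxA.
Qed.

(** ad X is skew-symmetric in some basis, so that <X, X> = tr (ad X)^2 = 0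
    forces ad X = 0. *)
Lemma killing_nondegenerate X : (forall Y, killing c X Y = 0) -> X = 0.
Proof.
move=> X0; apply: ad_inj; have [e e_unit S_skew] := ad_skew.
by apply: skew_mxtrace_sqr_eq0 e_unit (S_skew X) _; rewrite -killingE.
Qed.

Lemma killingDl X Y Z : killing c (X + Y) Z = killing c X Z + killing c Y Z.
Proof. by rewrite !killingE adD mulmxDl linearD. Qed.

Lemma killingNl X Y : killing c (- X) Y = - killing c X Y.
Proof. by rewrite !killingE adN mulNmx linearN. Qed.

Lemma killingC X Y : killing c X Y = killing c Y X.
Proof. by rewrite !killingE mxtrace_mulC. Qed.

Lemma killing_lie_eql x X X' Y : br X' x = br X x ->
  killing c x (br X' Y) = killing c x (br X Y).
Proof.
move=> E; rewrite !killing_invariant (lie_anticomm x X') (lie_anticomm x X).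
by rewrite E.
Qed.

Lemma killing_lie_eqr x X Y Y' : br Y' x = br Y x ->
  killing c x (br X Y') = killing c x (br X Y).
Proof.
move=> YY; have E Z : killing c x (br X Z) = - killing c x (br Z X).
  by rewrite lie_anticomm killingC killingNl killingC.
exact: etrans (E Y')
  (etrans (congr1 -%R (killing_lie_eql X YY)) (esym (E Y))).
Qed.

(** The value of the form does not depend on the elements X and Y that
    represent the tangent vectors: by invariance <x, [X, Y]> depends on X only
    through [x, X], and similarly for Y. *)
Lemma kksE x X Y :
  kks c x (br X x) (br Y x) = killing c x (br X Y).
Proof.
rewrite /kks -lieE; set X' := xget _ _; set Y' := xget _ _.
have X'x : br X' x = br X x.
  by apply: (@xgetPex _ 0 [set Z | br Z x = br X x]); exists X.
have Y'x : br Y' x = br Y x.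
  by apply: (@xgetPex _ 0 [set Z | br Z x = br Y x]); exists Y.
clearbody X' Y'.
have A := killing_lie_eql Y' X'x.
have B := killing_lie_eqr X Y'x.
exact: (eq_trans A B).
Qed.

(** The pairs (x, v) and (-x, -v) are represented by the same elements X. *)
Lemma kksN x v w : kks c (- x) (- v) (- w) = - kks c x v w.
Proof.
rewrite /kks -lieE killingNl.
have E v' : [set X | br X (- x) = - v'] = [set X | br X x = v'].
  by apply/seteqP; split=> [X|X] /=; rewrite lieNr;
    [move/oppr_inj|move=> ->].
by rewrite !E.
Qed.

End CompactSemisimple.

(** * Velocities of curves in products, opposites and antidiagonals *)

Section Tangent.
Variable R : realType.

Lemma is_derive_comp_linear (V W : normedModType R) (f : V -> W)
    (g : R -> V) v (t : R) :
  linear f -> continuous f -> is_derive t (1 : R) g v ->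
  is_derive t (1 : R) (fun s => f (g s)) (f v).
Proof.
move=> lf cf [dg <-].
pose h : {linear V -> W} := HB.pack f (GRing.isLinear.Build _ _ _ _ f lf).
have dg' : differentiable g t by apply/derivable1_diffP.
have df x : differentiable h x by exact: linear_differentiable.
apply: DeriveDef; first exact/derivable1_diffP/(differentiable_comp dg' (df _)).
rewrite (derive_comp _ dg' (df _)) deriveE //.
by rewrite diff_lin.
Qed.

Lemma is_derive_fst (V W : normedModType R) (g : R -> V * W) v (t : R) :
  is_derive t (1 : R) g v -> is_derive t (1 : R) (fun s => (g s).1) v.1.
Proof.
by apply: is_derive_comp_linear => [//|p]; exact: cvg_fst.
Qed.

Lemma is_derive_snd (V W : normedModType R) (g : R -> V * W) v (t : R) :
  is_derive t (1 : R) g v -> is_derive t (1 : R) (fun s => (g s).2) v.2.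
Proof.
by apply: is_derive_comp_linear => [//|p]; exact: cvg_snd.
Qed.

Lemma is_derive_pair (V W : normedModType R) (f : R -> V) (g : R -> W)
    v w (t : R) :
  is_derive t (1 : R) f v -> is_derive t (1 : R) g w ->
  is_derive t (1 : R) (fun s => (f s, g s)) (v, w).
Proof.
move=> [/derivable1_diffP df <-] [/derivable1_diffP dg <-].
have dfg := differentiable_pair df dg.
apply: DeriveDef; first exact/derivable1_diffP.
by rewrite !deriveE // diff_pair.
Qed.

Lemma is_derive_line (V W : normedModType R) (f : V -> W) o X w :
  is_derive o X f w -> is_derive (0 : R) (1 : R) (fun t => f (t *: X + o)) w.
Proof.
move=> [df <-]; apply: DeriveDef; first exact: (derivable1P f o X).1.
rewrite /derive; set q := (fun h => _); set q' := (fun h => _).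
suff -> : q = q' by [].
by apply/funext => h; rewrite /q /q' /= addr0 scale0r add0r [_%:A]mulr1.
Qed.

Lemma tangent_space_setX (V W : normedModType R) (A : set V) (B : set W) p v :
  tangent_space (A `*` B) p v <->
  tangent_space A p.1 v.1 /\ tangent_space B p.2 v.2.
Proof.
case: p v => [x y] [v w] /=; split.
  move=> [g [g0 gAB dg]]; split.
    exists (fun t => (g t).1); split; first by rewrite g0.
      by move=> t /=; have [? ?] := gAB t.
    exact: (is_derive_fst dg).
  exists (fun t => (g t).2); split; first by rewrite g0.
    by move=> t /=; have [? ?] := gAB t.
  exact: (is_derive_snd dg).
move=> [[f [f0 fA df]] [g [g0 gB dg]]].
exists (fun t => (f t, g t)); split; first by rewrite f0 g0.
  by move=> t; split; [exact: fA|exact: gB].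
exact: is_derive_pair.
Qed.

Lemma tangent_spaceN (V : normedModType R) (A : set V) x v :
  tangent_space [set y | A (- y)] (- x) v <-> tangent_space A x (- v).
Proof.
split=> -[g [g0 gA dg]]; exists (fun t => - g t); split.
- by rewrite g0 opprK.
- exact: gA.
- exact: is_deriveN.
- by rewrite g0.
- by move=> t; rewrite /= opprK.
- by rewrite -[v]opprK; exact: is_deriveN.
Qed.

Lemma tangent_space_antidiagonal (V : normedModType R) (A : set V) x v :
  tangent_space [set p : V * V | A p.1 /\ p.2 = - p.1] (x, - x) v <->
  tangent_space A x v.1 /\ v.2 = - v.1.
Proof.
case: v => [v w] /=; split.
  move=> [g [g0 gA dg]].
  have dg1 := is_derive_fst dg.
  split.
    exists (fun t => (g t).1); split=> //; first by rewrite g0.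
    by move=> t /=; have [? ?] := gA t.
  apply: is_derive_unique (is_derive_snd dg) _.
  rewrite (_ : (fun _ => _) = - (fun s => (g s).1)); first exact: is_deriveN.
  by apply/funext => t; have [_ ->] := gA t.
move=> [[g [g0 gA dg]] ->]; exists (fun t => (g t, - g t)); split.
- by rewrite g0.
- by move=> t; split => //=.
- by apply: is_derive_pair => //; exact: is_deriveN.
Qed.

Lemma dim_linear_image (V W : vectType R) (f : V -> W) (E : {vspace V}) :
  linear f -> injective f ->
  exists2 E' : {vspace W}, (forall w, w \in E' <-> exists2 v, v \in E & w = f v)
    & \dim E' = \dim E.
Proof.
move=> lf f_inj; pose h : {linear V -> W} :=
  HB.pack f (GRing.isLinear.Build _ _ _ _ f lf).
exists (linfun h @: E)%VS => [w|].
  split=> [/memv_imgP[v vE ->]|[v vE ->]]; first by exists v; rewrite // lfunE.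
  by rewrite (_ : f v = linfun h v) ?memv_img // lfunE.
apply: limg_dim_eq; apply/eqP; rewrite -subv0; apply/subvP => v.
rewrite memv_cap memv_ker lfunE memv0 => /andP[_ /eqP /= fv0]; apply/eqP.
by apply: f_inj; rewrite fv0; exact: esym (linear0 h).
Qed.

Lemma has_dim_antidiagonal (V : vectType R) (A : set V) (B : set (V * V)) d :
  has_dim A d -> (forall v, B v <-> A v.1 /\ v.2 = - v.1) -> has_dim B d.
Proof.
move=> [E EA <-] BA.
have lf : linear (fun v : V => (v, - v)).
  by move=> k a b; congr pair; rewrite /= opprD scalerN.
have f_inj : injective (fun v : V => (v, - v)) by move=> a b [].
have [E' E'E dE'] := dim_linear_image E lf f_inj.
exists E' => // -[v w]; rewrite BA EA E'E /=.
split=> [[vE ->]|[a aE [-> ->]]] //.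
by exists v.
Qed.

Lemma has_dim_setX (V : vectType R) (A B : set V) (C : set (V * V)) d :
  has_dim A d -> (forall v, B v <-> A (- v)) ->
  (forall v, C v <-> A v.1 /\ B v.2) -> has_dim C d.*2.
Proof.
move=> [E EA <-] BA CAB.
have ll : linear (fun v : V => (v, 0 : V)).
  by move=> k a b; congr pair; rewrite /= scaler0 addr0.
have lr : linear (fun v : V => (0 : V, v)).
  by move=> k a b; congr pair; rewrite /= scaler0 addr0.
have l_inj : injective (fun v : V => (v, 0 : V)) by move=> a b [].
have r_inj : injective (fun v : V => (0 : V, v)) by move=> a b [].
have [E1 E1E dE1] := dim_linear_image E ll l_inj.
have [E2 E2E dE2] := dim_linear_image E lr r_inj.
exists (E1 + E2)%VS => [[v w]|].
  rewrite CAB BA !EA memvN /=.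
  split=> [[vE wE]|/memv_addP[a /E1E[a' aE ->] [b /E2E[b' bE ->]]]].
    rewrite (_ : (v, w) = (v, 0) + (0, w)); last first.
      by congr pair; rewrite /= ?addr0 ?add0r.
    by apply: memv_add; [apply/E1E; exists v|apply/E2E; exists w].
  by move=> [-> ->]; rewrite /= addr0 add0r.
rewrite dimv_disjoint_sum ?dE1 ?dE2 ?addnn //; apply/eqP; rewrite -subv0.
apply/subvP => -[v w]; rewrite memv_cap.
move=> /andP[/E1E[a _ [_ ->]] /E2E[b _ [-> _]]].
by rewrite memv0.
Qed.

End Tangent.

(** * Adjoint orbits and their diagonal products *)

Section Orbits.
Variables (R : realType) (n : nat) (U : lieGroupType R n).
Variable c : chart 'rV[R]_n U.
Hypotheses (c_atlas : atlas c) (c_one : cdom c 1%g).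
Local Notation u := 'rV[R]_n.
Local Notation o := (c 1%g).
Local Notation ad := (ad_mx c).
Local Notation Adm := (Ad_mx c).
Local Notation br := (lie c).

Lemma AdN g X : Ad c g (- X) = - Ad c g X.
Proof. by rewrite -!(mulmx_Ad c_atlas c_one) mulNmx. Qed.

Lemma AdVK g X : Ad c g^-1%g (Ad c g X) = X.
Proof. by rewrite -(Ad_mul c_atlas c_one) mulVg (Ad1 c_atlas c_one). Qed.

Lemma adjoint_orbit_eq x y :
  adjoint_orbit c x y -> adjoint_orbit c y = adjoint_orbit c x.
Proof.
move=> [g _ <-]; apply/seteqP; split=> _ [h _ <-].
  by exists (h * g)%g => //; rewrite (Ad_mul c_atlas c_one).
by exists (h * g^-1)%g => //; rewrite (Ad_mul c_atlas c_one) AdVK.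
Qed.

Lemma adjoint_orbitN x y : adjoint_orbit c (- x) y <-> adjoint_orbit c x (- y).
Proof.
split=> -[g _ E]; exists g => //; first by rewrite -E AdN opprK.
by rewrite AdN E opprK.
Qed.

Lemma adjoint_orbit_refl x : adjoint_orbit c x x.
Proof. by exists 1%g => //; rewrite (Ad1 c_atlas c_one). Qed.

Lemma diag_orbit_antidiagonal x :
  diag_orbit c (x, - x) = [set p | adjoint_orbit c x p.1 /\ p.2 = - p.1].
Proof.
apply/seteqP; split=> [_ [g _ <-]|[y z] /= [[g _ <-] ->]] /=.
  by split; [exists g|rewrite AdN].
by exists g => //=; rewrite AdN.
Qed.

Lemma curve_is_derive X x :
  is_derive (0 : R) (1 : R) (fun t => Ad c (cinv c (t *: X + o)) x) (br X x).
Proof.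
rewrite lieE.
exact: is_derive_line (bracket_is_derive c_atlas c_one X x).
Qed.

Lemma curve0 X x : Ad c (cinv c ((0 : R) *: X + o)) x = x.
Proof. by rewrite scale0r add0r (cinvK c_atlas c_one) (Ad1 c_atlas c_one). Qed.

Lemma diag_orbit_tangent p X :
  tangent_space (diag_orbit c p) p (br X p.1, br X p.2).
Proof.
case: p => x y /=.
exists (fun t => (Ad c (cinv c (t *: X + o)) x, Ad c (cinv c (t *: X + o)) y)).
split; first by rewrite !curve0.
  by move=> t; exists (cinv c (t *: X + o)).
by apply: is_derive_pair; exact: curve_is_derive.
Qed.

(** A tangent vector at (x, -x) is of the form (v, -v), and the two terms of the
    product form cancel. *)
Lemma isotropic_antidiagonal (F : set u) :
  isotropic c [set p | F p.1 /\ p.2 = - p.1].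
Proof.
move=> [x y] /= [_ ->] v w.
move=> /tangent_space_antidiagonal[_ v2] /tangent_space_antidiagonal[_ w2].
by rewrite /kks2 /= v2 w2 (kksN c_atlas c_one) subrr.
Qed.

Hypothesis U_compact : compact [set: U].
Hypothesis U_semisimple : semisimple c.

(** On the tangent vectors ([X, x], [X, y]) and ([Y, x], [Y, y]) the form is
    <x + y, [X, Y]> = <[x + y, X], Y>. If this vanishes for all X and Y then
    x + y is central, hence zero. *)
Lemma isotropic_diag_orbit p : isotropic c (diag_orbit c p) -> p.2 = - p.1.
Proof.
move=> iso; apply/eqP; rewrite -addr_eq0 addrC; apply/eqP.
apply: (ad_inj c_atlas c_one U_semisimple); apply: mulmx_rV_inj => X.
rewrite mulmx0 (mulmx_ad c_atlas c_one).
apply: (killing_nondegenerate c_atlas c_one U_compact U_semisimple) => Y.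
rewrite -(killing_invariant c_atlas c_one) (killingDl c_atlas c_one).
have pp : diag_orbit c p p.
  by exists 1%g => //; rewrite !(Ad1 c_atlas c_one); case: (p).
have := iso p pp _ _ (diag_orbit_tangent p X) (diag_orbit_tangent p Y).
rewrite /kks2 /=.
by rewrite !(kksE c_atlas c_one U_semisimple).
Qed.

(** Write v = [x, W] + z with [x, z] = 0. Along a curve g in the orbit the
    matrices ad (g t) are similar to ad x, and their velocity is the sum of a
    commutator with ad x and of ad z, which commutes with ad x; hence
    ad z = 0. *)
Lemma adjoint_orbit_tangent x v :
  tangent_space (adjoint_orbit c x) x v <-> exists X, v = br X x.
Proof.
split=> [[g [g0 gF dg]]|[X ->]]; last first.
  exists (fun t => Ad c (cinv c (t *: X + o)) x); split; first exact: curve0.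
    by move=> t; exists (cinv c (t *: X + o)).
  exact: curve_is_derive.
have [e e_unit S_skew] := ad_skew c_atlas c_one U_compact.
have /submxP[D DE] := skew_sub_sqrmx e_unit (S_skew x).
(* Since ad x = D (ad x)^2, z is the component of v in the kernel of ad x. *)
pose z := v - v *m D *m ad x.
have vE : v = br x (v *m D) + z.
  by rewrite -(mulmx_ad c_atlas c_one) addrC subrK.
have zS : br x z = 0.
  rewrite -(mulmx_ad c_atlas c_one) mulmxBl -!mulmxA -DE subrr.
  by [].
have zcomm : ad z *m ad x = ad x *m ad z.
  apply/eqP; rewrite -subr_eq0 -(ad_lie c_atlas c_one) zS; apply/eqP.
  exact: ad0.
have dM : is_derive (0 : R) (1 : R) (fun t => ad (g t))
    (ad (v *m D) *m ad x - ad x *m ad (v *m D) + ad z).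
  rewrite -(ad_lie c_atlas c_one) -(adD c_atlas c_one) -vE.
  exact: is_derive_linear (ad_linear c_atlas c_one) dg.
have : ad z = 0.
  apply: (isospectral_derivative e_unit (S_skew x) _ _ dM zcomm).
    by rewrite g0.
  move=> t; have [h _ <-] := gF t; exists (Adm h); first exact: Adm_unit.
  exact: ad_Ad.
move=> /(ad_inj c_atlas c_one U_semisimple) z0.
exists (- (v *m D)); rewrite (lieNl c_atlas c_one).
by rewrite -(lie_anticomm c_atlas c_one U_semisimple) {1}vE z0 addr0.
Qed.

Lemma has_dim_adjoint_orbit_tangent x :
  exists d, has_dim (tangent_space (adjoint_orbit c x) x) d.
Proof.
pose E := limg (linfun (mulmxr (ad x) : u -> u)).
exists (\dim E), E => // v; rewrite adjoint_orbit_tangent; split.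
  move=> [X ->]; apply/memv_imgP; exists (- X); first exact: memvf.
  rewrite lfunE /= mulNmx (mulmx_ad c_atlas c_one).
  exact: (lie_anticomm c_atlas c_one U_semisimple).
move=> /memv_imgP[X _ ->]; exists (- X).
rewrite lfunE /= (mulmx_ad c_atlas c_one) (lieNl c_atlas c_one).
exact: (lie_anticomm c_atlas c_one U_semisimple).
Qed.

Lemma lagrangian_antidiagonal x : lagrangian c
  [set p | adjoint_orbit c x p.1 /\ p.2 = - p.1]
  (adjoint_orbit c x `*` [set y | adjoint_orbit c x (- y)]).
Proof.
split=> [|[y z] /= [yx ->]]; first exact: isotropic_antidiagonal.
rewrite -(adjoint_orbit_eq yx).
have [d dimd] := has_dim_adjoint_orbit_tangent y.
exists d; split.
  by apply: has_dim_antidiagonal dimd _ => v; exact: tangent_space_antidiagonal.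
apply: (has_dim_setX
  (B := tangent_space [set y' | adjoint_orbit c y (- y')] (- y)) dimd).
  by move=> v; exact: tangent_spaceN.
by move=> v; exact: tangent_space_setX.
Qed.

(** As imul Z = - imPart Z, the map imul intertwines AdC g and Ad g. *)
Lemma imulN_AdC g (H : 'rV[R[i]]_n) : imul (- AdC c g H) = - Ad c g (imul H).
Proof.
have imE (Z : 'rV[R[i]]_n) : imul Z = - imPart Z.
  apply/rowP => j; rewrite !mxE; case: (Z 0 j) => a b.
  by rewrite /= mul0r mul1r sub0r.
rewrite !imE AdN opprK; apply/rowP => j; rewrite !mxE /=.
by rewrite !(mul0r, mul1r, add0r, addr0, mulr0, oppr0, opprK).
Qed.

End Orbits.

Theorem proposition5p3 (R : realType) (n : nat) (U : lieGroupType R n)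
    (U_compact : compact [set: U]) (U_connected : connected [set: U])
    (c : chart 'rV[R]_n U) (c_atlas : atlas c) (c_one : cdom c 1%g)
    (U_semisimple : semisimple c)
    (T : set U) (T_torus : maximal_torus T)
    (P : set ('rV[R[i]]_n -> R)) (P_positive : positive_system c T P)
    (H : 'rV[R[i]]_n) (H_dominant : closed_chamber c T P H)
    (w0 : 'rV[R[i]]_n -> 'rV[R[i]]_n) (w0_longest : longest c T P w0) :
  let F := adjoint_orbit c (imul H) in
  let Fdual := adjoint_orbit c (imul (- w0 H)) in
  let isotropic_orbit := fun O : set ('rV[R]_n * 'rV[R]_n) =>
    (exists2 p, (F `*` Fdual) p & O = diag_orbit c p) /\ isotropic c O in
  (exists! O, isotropic_orbit O) /\
  (forall O, isotropic_orbit O ->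
     [/\ lagrangian c O (F `*` Fdual),
         forall x, F x -> Fdual (- x) &
         O = [set p | F p.1 /\ p.2 = - p.1]]).
Proof.
move=> F Fdual isotropic_orbit.
have FdualE : Fdual = [set y | F (- y)].
  have [[g _ w0E] _] := w0_longest; have [HR _] := H_dominant.
  rewrite /Fdual (w0E H HR) imulN_AdC //.
  have gH : F (Ad c g (imul H)) by exists g.
  by apply/seteqP; split=> y;
    rewrite /= adjoint_orbitN // (adjoint_orbit_eq c_atlas c_one gH).
pose graph := [set p : 'rV[R]_n * 'rV[R]_n | F p.1 /\ p.2 = - p.1].
have only_graph O : isotropic_orbit O -> O = graph.
  move=> [[[x y] /= [Fx _] ->]].
  move=> /(isotropic_diag_orbit c_atlas c_one U_compact U_semisimple) /= ->.
  by rewrite diag_orbit_antidiagonal // (adjoint_orbit_eq c_atlas c_one Fx).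
have FH : F (imul H) by exact: adjoint_orbit_refl.
have graph_orbit : isotropic_orbit graph.
  split; last exact: isotropic_antidiagonal.
  exists (imul H, - imul H); last by rewrite diag_orbit_antidiagonal.
  by split => //=; rewrite FdualE /= opprK.
split; first by exists graph; split => // O /only_graph.
move=> O /only_graph ->; split => //.
  by rewrite FdualE; exact: lagrangian_antidiagonal.
by move=> x Fx; rewrite FdualE /= opprK.
Qed.
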